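(* There is an absolute constant $A>0$ such that for every $\varepsilon>0$, all integers $q\geq 1$ and $k\geq 0$, \[ \frac1{\varphi(q)}\sum_{\substack{a=1\\(a,q)=1}}^{q}\operatorname{c}_0\!\left(\tfrac aq\right)^{k}=H_kq^k+O_\varepsilon\!\left(q^{k-1+\varepsilon}(Ak\log q)^{2k}\right), \] where \[ H_k:=(i\pi^{2})^{-k}\sum_{\substack{(n_1,\dots,n_k)\in(\mathbb{Z}\setminus\{0\})^{k}\\ n_1+\cdots+n_k= 0}} \frac{d(|n_1|)\cdots d(|n_k|)}{n_1\cdots n_k} \] and the implied constant depends only on $\varepsilon$.
   Context: For coprime integers $a$ and $q\geq1$, define the cotangent sum $\operatorname{c}_0(a/q):=-\sum_{m=1}^{q-1}\frac mq\cot\!\left(\frac{\pi m a}{q}\right)$. Here $\varphi$ is Euler's totient function and $d(n)$ is the number of positive divisors of $n$.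
   Formalization: The case q = 1 with k ≥ 2 even is excluded: there log q = 0 makes the error term vanish and c_0(1/1) = 0, while H_k > 0 (e.g. H_2 = (2/π⁴)Σ d(n)²/n²), so the printed claim fails. *)

(* Defs.v *)
From HB Require Import structures.
From mathcomp Require Import all_boot all_order all_algebra.
From mathcomp Require Import all_classical all_reals all_analysis.
From mathcomp Require Export complex.

Set Implicit Arguments.
Unset Strict Implicit.
Unset Printing Implicit Defensive.

Import Order.TTheory GRing.Theory Num.Theory.
Local Open Scope classical_set_scope.
Local Open Scope ring_scope.

Definition cot {R : realType} (x : R) : R := cos x / sin x.

(* [c0 a q] is c_0(a/q); it is only meant for coprime [a] and [q >= 1], in
   which case every [cot] below is taken off its poles. *)
Definition c0 {R : realType} (a : int) (q : nat) : R :=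
  - \sum_(1 <= m < q) (m%:R / q%:R) * cot (pi * m%:R * a%:~R / q%:R).

Definition num_divisors (n : nat) : nat := size (divisors n).

Definition zero_sum_tuples (k : nat) : set (k.-tuple int) :=
  [set n | (forall i : 'I_k, tnth n i != 0) /\ \sum_(i < k) tnth n i = 0].

Definition H_term {R : realType} (k : nat) (n : k.-tuple int) : R :=
  (\prod_(i < k) (num_divisors `|tnth n i|%N)%:R) /
  (\prod_(i < k) (tnth n i)%:~R).

(* Unordered sum of a real family over the set [D]: the sum of the positive
   parts minus the sum of the negative parts. This is the usual value whenever
   the family is absolutely summable on [D]. *)
Definition unordered_sum {R : realType} {T : choiceType} (D : set T)
    (f : T -> R) : R :=
  fine (esum D (EFin \o f)^\+ - esum D (EFin \o f)^\-)%E.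

Definition H {R : realType} (k : nat) : R[i] :=
  ('i%C * ((pi : R) ^+ 2)%:C%C) ^- k *
  (unordered_sum (@zero_sum_tuples k) (@H_term R k))%:C%C.

(* Main.v *)
Require Import Defs.
From mathcomp Require Import all_boot all_order all_algebra.
From mathcomp Require Import all_classical all_reals all_analysis.
From mathcomp Require Import cyclic ring lra zify.
Import Order.TTheory GRing.Theory Num.Theory.
Import numFieldNormedType.Exports.
Set Implicit Arguments.
Unset Strict Implicit.
Unset Printing Implicit Defensive.
Local Open Scope ring_scope.

(* Write b for the inverse of a mod q. Finite Fourier inversion of the sawtooth
   function gives
     c_0(a/q) = (2q)^-1 sum_(j, h < q) cot(pi j/q) cot(pi h/q) sin(2 pi j h b/q),
   and cot(pi j/q) = q/(pi j) * w(j) for j < q/2, with 0 <= w(j) <= 1 and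
   1 - w(j) = O(j/q). Folding j -> q - j and grouping by n = j h,
     c_0(a/q) = q (i pi^2)^-1 sum_(0 < |n| < q^2) d_w(|n|)/n e(n b/q),
   where d_w is the divisor function weighted by w(j) w(h). In the k-th moment the
   average over b of e((n_1 + ... + n_k) b/q) is a Ramanujan sum.
   - Tuples with nonzero sum: |c_q(h)| <= sum_(g | (q, h)) g, some n_i satisfies
     |n_i| >= g/k, and summing over the progression mod g containing this n_i
     gains a factor 1/g; with q <= phi(q) d(q) and d(n) = O(n^eps) this is
     O(q^(-1+eps) (A k log q)^(2k)).
   - Tuples with zero sum: replacing d_w by d costs a factor
     min(1, 8 k max|n_i|/q); the largest n_i is determined by the others, and
     Rankin's trick with exponent 1/(4 log q), shared among the other k - 1
     variables, bounds the sum by powers of zeta(1 + 1/(4 k log q))^2. *)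

(** * Divisors and coprimality *)

Lemma ler_sum_subseq (R : numDomainType) (I : eqType) (F : I -> R) (s t : seq I) :
  uniq s -> uniq t -> {subset s <= t} -> (forall i, 0 <= F i) ->
  \sum_(i <- s) F i <= \sum_(i <- t) F i.
Proof.
move=> us ut st F0; rewrite [leRHS](bigID (mem s)) /=.
have -> : \sum_(i <- t | i \in s) F i = \sum_(i <- s) F i.
  rewrite -big_filter; apply: perm_big; apply: uniq_perm; rewrite ?filter_uniq//.
  by move=> i; rewrite mem_filter andbC; case: (boolP (i \in s)) => [/st->|]; rewrite ?andbF.
by rewrite lerDl; apply: sumr_ge0.
Qed.

(** Regrouping by n = j h: for fixed j, the multiples of j up to [N] are the j h with j h <= [N].
    This carries sums weighted by divisor functions to double sums. *)
Lemma sum_divisors_swap (V : nmodType) (F : nat -> nat -> V) (N : nat) :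
  \sum_(1 <= n < N.+1) \sum_(j <- divisors n) F j (n %/ j)%N =
  \sum_(1 <= j < N.+1) \sum_(1 <= h < N.+1 | (j * h <= N)%N) F j h.
Proof.
transitivity (\sum_(1 <= n < N.+1) \sum_(1 <= j < N.+1 | (j %| n)%N)
   F j (n %/ j)%N).
  apply: eq_big_nat => n /andP[n0 nN].
  rewrite -[RHS]big_filter; apply: perm_big; apply: uniq_perm.
  - exact: divisors_uniq.
  - by rewrite filter_uniq// iota_uniq.
  - move=> j; rewrite mem_filter mem_index_iota -dvdn_divisors//.
    case: (boolP (j %| n)%N) => //= jn; rewrite (dvdn_gt0 n0 jn)/=.
    by rewrite (leq_ltn_trans (dvdn_leq n0 jn) nN).
rewrite (exchange_big_dep_nat predT)//=; apply: eq_big_nat => j /andP[j0 jN].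
rewrite -big_filter -[RHS]big_filter.
transitivity (\sum_(n <- [seq (j * h)%N | h <- [seq h <- index_iota 1 N.+1 | (j * h <= N)%N]])
   F j (n %/ j)%N).
  apply: perm_big; apply: uniq_perm.
  - by rewrite filter_uniq// iota_uniq.
  - rewrite map_inj_in_uniq ?filter_uniq ?iota_uniq// => x y _ _ /eqP.
    by rewrite eqn_pmul2l// => /eqP.
  - move=> n; rewrite mem_filter mem_index_iota; apply/idP/idP.
    + case/and3P=> /dvdnP[h ->] n0 nN; rewrite mulnC; apply: map_f.
      rewrite mem_filter mem_index_iota; move: n0 nN.
      rewrite muln_gt0 ltnS => /andP[h0 _] hjN.
      by rewrite mulnC hjN h0 ltnS (leq_trans _ hjN)// leq_pmulr.
    + case/mapP => h; rewrite mem_filter mem_index_iota => /and3P[jh h0 hN] ->.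
      by rewrite dvdn_mulr//= muln_gt0 j0 h0/= ltnS.
by rewrite big_map; apply: eq_bigr => h _; rewrite mulKn.
Qed.

(** The map t -> (gcd(t, a), t / gcd(t, a)) injects the divisors of a b into pairs of divisors of a
    and of b. *)
Lemma num_divisorsM_le (a b : nat) : (0 < a)%N -> (0 < b)%N ->
  (num_divisors (a * b) <= num_divisors a * num_divisors b)%N.
Proof.
move=> a0 b0; rewrite /num_divisors.
rewrite -(size_map (fun t => (gcdn t a, t %/ gcdn t a)%N) (divisors (a * b)%N)).
rewrite -(size_allpairs (@pair nat nat)); apply: uniq_leq_size.
  rewrite map_inj_in_uniq ?divisors_uniq// => x y _ _ [e1 e2].
  rewrite -(divnK (dvdn_gcdl x a)) -(divnK (dvdn_gcdl y a)) e2.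
  by rewrite e1.
move=> _ /mapP[t + ->]; rewrite -dvdn_divisors ?muln_gt0 ?a0// => tab.
apply/allpairsP; exists (gcdn t a, t %/ gcdn t a)%N; split=> //=.
  by rewrite -dvdn_divisors// dvdn_gcdr.
rewrite -dvdn_divisors//.
have g0 : (0 < gcdn t a)%N by rewrite gcdn_gt0 a0 orbT.
have cop : coprime (t %/ gcdn t a) (a %/ gcdn t a).
  rewrite /coprime -(eqn_pmul2r g0) muln_gcdl !divnK ?dvdn_gcdl ?dvdn_gcdr//.
  by rewrite mul1n.
rewrite -(Gauss_dvdr _ cop) -(@dvdn_pmul2r (gcdn t a))// divnK ?dvdn_gcdl//.
by rewrite mulnAC divnK ?dvdn_gcdr.
Qed.

Lemma num_divisors_expn_le (p e : nat) : prime p -> (num_divisors (p ^ e) <= e.+1)%N.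
Proof.
move=> pp; rewrite /num_divisors -[leqRHS](size_iota 0).
rewrite -[leqRHS](size_map (expn p)); apply: uniq_leq_size; first exact: divisors_uniq.
move=> t; rewrite -dvdn_divisors ?expn_gt0 ?prime_gt0// => /(dvdn_pfactor _ _ pp)[m me ->].
by apply: map_f; rewrite mem_iota.
Qed.

(** Splitting off the full power of the least prime factor is the induction step of the coprimality
    sieve, the totient bound and the divisor bound below. *)
Lemma pdiv_split (n : nat) : (1 < n)%N ->
  exists p e m : nat, [/\ prime p, n = (p ^ e.+1 * m)%N, coprime p m, (0 < m)%N & (m < n)%N].
Proof.
move=> n1; have n0 := ltnW n1; have pp := pdiv_prime n1.
set p := pdiv n in pp *; have [m pm ne] := pfactor_coprime pp n0.
have e0 : (0 < logn p n)%N by rewrite logn_gt0 pi_pdiv.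
exists p, (logn p n).-1, m.
have m0 : (0 < m)%N by move: n0; rewrite ne muln_gt0 => /andP[].
rewrite prednK// mulnC; split=> //; rewrite [ltnRHS]ne ltn_Pmulr//.
by rewrite -(exp1n (logn p n)) ltn_exp2r// prime_gt1.
Qed.

Section CoprimeSum.
Variable R : numDomainType.

(* Inclusion-exclusion over the primes dividing [q], without signs. *)
Lemma norm_sum_coprime (N q : nat) (f : nat -> R) : (0 < q)%N ->
  `|\sum_(0 <= b < N | coprime b q) f b| <=
    \sum_(m <- divisors q) `|\sum_(0 <= b < N | (m %| b)%N) f b|.
Proof.
elim/ltn_ind: q f => q IH f q0; have [q1|q1] := leqP q 1.
  have -> : q = 1%N by apply/eqP; rewrite eqn_leq q1 q0.
  rewrite big_seq1; under eq_bigl do rewrite coprimen1.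
  by under [in leRHS]eq_bigl do rewrite dvd1n.
have [p [e [m [pp qE pm m0 mq]]]] := pdiv_split q1.
have p0 := prime_gt0 pp.
have copE b : coprime b q = coprime b m && ~~ (p %| b)%N.
  by rewrite qE coprimeMr coprime_pexpr// (coprime_sym b p) prime_coprime// andbC.
under eq_bigl do rewrite copE.
(* Sieving out p leaves a difference of two sums over b coprime to m, the second with f cut off to
   multiples of p; the induction hypothesis is general in f and applies to both. *)
have -> : \sum_(0 <= b < N | coprime b m && ~~ (p %| b)%N) f b =
  \sum_(0 <= b < N | coprime b m) f b -
  \sum_(0 <= b < N | coprime b m) (if (p %| b)%N then f b else 0).
  rewrite -big_mkcondr/=.
  by rewrite [in RHS](bigID (fun b => (p %| b)%N) (fun b => coprime b m))/= addrAC subrr add0r.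
apply: le_trans (ler_normB _ _) _.
apply: le_trans (lerD (IH _ mq f m0) (IH _ mq _ m0)) _.
have -> : \sum_(k <- divisors m) `|\sum_(0 <= b < N | (k %| b)%N) (if (p %| b)%N then f b else 0)|
  = \sum_(k <- [seq (p * k)%N | k <- divisors m]) `|\sum_(0 <= b < N | (k %| b)%N) f b|.
  rewrite big_map big_seq [RHS]big_seq; apply: eq_bigr => k.
  rewrite -dvdn_divisors// => km; rewrite -big_mkcondr/=; congr (`|_|).
  apply: eq_bigl => b; rewrite Gauss_dvd 1?andbC//.
  by apply: coprime_dvdr pm.
(* The divisors k of m and the numbers p k are pairwise distinct divisors of q, as p does not divide
   m. *)
rewrite -big_cat/=; apply: ler_sum_subseq => //.
- rewrite cat_uniq divisors_uniq map_inj_uniq ?divisors_uniq ?andbT /=; last first.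
    by move=> x y /eqP; rewrite eqn_pmul2l// => /eqP.
  apply/hasPn => _ /mapP[k _ ->]; rewrite -dvdn_divisors//.
  apply: contraTN pm => pkm; rewrite prime_coprime// negbK.
  exact: dvdn_trans (dvdn_mulr _ (dvdnn p)) pkm.
- exact: divisors_uniq.
- move=> k; rewrite mem_cat -!dvdn_divisors// qE => /orP[km|/mapP[l + ->]].
    exact: dvdn_mull.
  by rewrite -dvdn_divisors// => lm; rewrite dvdn_mul// expnS dvdn_mulr.
Qed.

End CoprimeSum.

(** Induction on q = p^(e+1) m: p^(e+1) <= 2 (p - 1) p^e, and d(q) >= 2 d(m) because k and p k both
    divide q whenever k divides m. *)
Lemma leq_totient_num_divisors q : (0 < q)%N -> (q <= totient q * num_divisors q)%N.
Proof.
elim/ltn_ind: q => q IH q0; have [q1|q1] := leqP q 1.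
  by have -> : q = 1%N by apply/eqP; rewrite eqn_leq q1 q0.
have [p [e [m [pp qE pm m0 mq]]]] := pdiv_split q1.
have p1 := prime_gt1 pp; have p0 := prime_gt0 pp.
have d2 : (2 * num_divisors m <= num_divisors q)%N.
  rewrite mul2n -addnn /num_divisors -[X in (_ + X)%N](size_map (muln p)) -size_cat.
  apply: uniq_leq_size.
    rewrite cat_uniq divisors_uniq map_inj_uniq ?divisors_uniq ?andbT /=; last first.
      by move=> x y /eqP; rewrite eqn_pmul2l// => /eqP.
    apply/hasPn => _ /mapP[k _ ->]; rewrite -dvdn_divisors//.
    apply: contraTN pm => pkm; rewrite prime_coprime// negbK.
    exact: dvdn_trans (dvdn_mulr _ (dvdnn p)) pkm.
  move=> k; rewrite mem_cat -!dvdn_divisors// qE => /orP[km|/mapP[l + ->]].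
    exact: dvdn_mull.
  by rewrite -dvdn_divisors// => lm; rewrite dvdn_mul// expnS dvdn_mulr.
have -> : totient q = (p.-1 * p ^ e * totient m)%N.
  by rewrite qE totient_coprime ?coprimeXl// totient_pfactor.
rewrite {1}qE expnS; apply: leq_trans (_ : 2 * p.-1 * p ^ e * (totient m * num_divisors m) <= _)%N.
  by rewrite leq_mul ?IH// leq_mul//; lia.
by rewrite [leqLHS](_ : _ = p.-1 * p ^ e * totient m * (2 * num_divisors m))%N ?leq_mul//; ring.
Qed.

(** * The divisor bound d(n) = O(n^eps) *)

Section DivisorBound.
Variable R : realType.

(** If p^eps >= 2 then i + 1 <= 2^i <= p^(i eps), so such prime powers cost nothing; each smaller
    prime costs one factor [K], whence the constant [K ^+ B]. *)
Lemma num_divisors_le_powR (eps : R) : 0 < eps ->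
  exists2 C : R, 1 <= C & forall n, (0 < n)%N -> (num_divisors n)%:R <= C * n%:R `^ eps.
Proof.
move=> e0; have l2 : 0 < ln (2 : R) by rewrite ln_gt0// ltr1n.
set t := eps * ln 2; have t0 : 0 < t by rewrite mulr_gt0.
(* Chosen so that i + 1 <= [K] (1 + i t) <= [K] e^(i t), where e^t = 2^eps <= p^eps for every prime
   p. *)
pose K := Num.max 1 t^-1; have K1 : 1 <= K by rewrite le_max lexx.
have Kt : 1 <= K * t by rewrite -ler_pdivrMr// mul1r le_max lexx orbT.
pose B := (Num.truncn (2 `^ eps^-1 : R)).+1.
have BP p : (B <= p)%N -> 2 <= p%:R `^ eps.
  move=> Bp; have : (2 : R) `^ eps^-1 <= p%:R.
    by apply: ltW; apply: lt_le_trans (truncnS_gt _) _; rewrite ler_nat.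
  move=> /(ge0_ler_powR (ltW e0)); rewrite !nnegrE powR_ge0 ler0n => /(_ isT isT).
  by rewrite -powRrM mulVf ?gt_eqF// powRr1.
pose cnt n := size [seq p <- primes n | (p < B)%N].
have expS i : (i.+1%:R : R) <= 2 ^+ i.
  by rewrite -natrX ler_nat ltn_expl.
have expK (p i : nat) : (1 < p)%N -> i.+1%:R <= K * (p%:R `^ eps) ^+ i.
  move=> p1; have p0 : 0 < (p%:R : R) by rewrite ltr0n ltnW.
  apply: (@le_trans _ _ (K * expR t ^+ i)).
    rewrite -expRM_natl; apply: (@le_trans _ _ (K * (1 + i%:R * t))).
      have : 0 <= (i%:R : R) by []. rewrite -natr1; nra.
    by rewrite ler_wpM2l ?expR_ge1Dx// (le_trans ler01).
  rewrite ler_wpM2l ?(le_trans ler01)// lerXn2r ?nnegrE ?expR_ge0 ?powR_ge0//.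
  rewrite /powR gt_eqF// ler_expR ler_pM2l// ler_ln ?posrE// ler_nat.
  by [].
have main n : (0 < n)%N -> (num_divisors n)%:R <= K ^+ cnt n * n%:R `^ eps.
  elim/ltn_ind: n => n IH n0; have [n1|n1] := leqP n 1.
    have -> : n = 1%N by apply/eqP; rewrite eqn_leq n1 n0.
    by rewrite powR1 mulr1 exprn_ege1.
  have [p [i [m [pp nE pm m0 mn]]]] := pdiv_split n1.
  have cntE : ((p < B) + cnt m <= cnt n)%N.
    have -> : ((p < B) + cnt m = size [seq r <- p :: primes m | (r < B)%N])%N.
      by rewrite /=; case: ifP.
    apply: uniq_leq_size.
      rewrite filter_uniq//= primes_uniq andbT mem_primes pp m0/=.
      by rewrite -prime_coprime.
    move=> r; rewrite !mem_filter inE !mem_primes n0 nE => /andP[->]/=.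
    case/orP => [/eqP->|/and3P[-> _ rm]]; first by rewrite pp expnS -mulnA dvdn_mulr.
    by rewrite dvdn_mull.
  apply: (@le_trans _ _ (i.+2%:R * (num_divisors m)%:R)).
    rewrite -natrM ler_nat nE; apply: leq_trans (num_divisorsM_le _ m0) _.
      by rewrite expn_gt0 prime_gt0.
    by rewrite leq_mul2r num_divisors_expn_le ?orbT.
  have -> : (n%:R : R) `^ eps = (p%:R `^ eps) ^+ i.+1 * m%:R `^ eps.
    rewrite nE natrM powRM// natrX; congr (_ * _).
    rewrite -(powR_mulrn i.+1 (ler0n R p)) -(powR_mulrn i.+1 (powR_ge0 p%:R eps)).
    by rewrite -!powRrM mulrC.
  apply: (@le_trans _ _ (K ^+ (p < B)%N * (p%:R `^ eps) ^+ i.+1 * (K ^+ cnt m * m%:R `^ eps))).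
    apply: ler_pM => //; last exact: IH.
    case: ltnP => [_|Bp]; first by rewrite expr1 expK// prime_gt1.
    rewrite expr0 mul1r; apply: le_trans (expS _) _.
    by rewrite lerXn2r ?nnegrE ?powR_ge0// BP.
  rewrite [leLHS](_ : _ = K ^+ ((p < B) + cnt m) * ((p%:R `^ eps) ^+ i.+1 * m%:R `^ eps)); last first.
    by rewrite exprD mulrACA.
  rewrite ler_wpM2r ?mulr_ge0 ?exprn_ge0 ?powR_ge0//.
  by rewrite ler_weXn2l.
exists (K ^+ B); first by rewrite exprn_ege1.
move=> n n0; apply: le_trans (main n n0) _; rewrite ler_wpM2r ?powR_ge0//.
rewrite ler_weXn2l// -[leqRHS](size_iota 0); apply: uniq_leq_size.
  by rewrite filter_uniq// primes_uniq.
by move=> r; rewrite mem_filter mem_iota => /andP[].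
Qed.

End DivisorBound.

(** * Finite trigonometric sums *)

Section Trigonometry.
Variable R : realType.
Implicit Types x y : R.

Lemma sinx_le_x x : 0 <= x -> sin x <= x.
Proof.
move=> x0; have [c _] := @MVT_segment R sin cos 0 x x0
  (fun y _ => is_derive_sin y) (continuous_subspaceT (@continuous_sin R)).
rewrite sin0 !subr0 => ->.
by rewrite ler_piMl// cos_le1.
Qed.

Lemma xcosx_le_sinx x : 0 <= x <= pi -> x * cos x <= sin x.
Proof.
case/andP=> x0 xpi; have [c /[!in_itv]/= /andP[c0 cx]] := @MVT_segment R sin cos 0 x x0
  (fun y _ => is_derive_sin y) (continuous_subspaceT (@continuous_sin R)).
rewrite sin0 !subr0 => ->; rewrite mulrC ler_wpM2r//.
rewrite leNgt ltr_cos -?leNgt//; rewrite in_itv/= ?x0 ?xpi ?c0//.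
exact: le_trans cx xpi.
Qed.

Lemma cosx_ge1Nx x : 0 <= x -> 1 - x <= cos x.
Proof.
move=> x0; have [c _] := @MVT_segment R cos (fun x => - sin x) 0 x x0
  (fun y _ => is_derive_cos y) (continuous_subspaceT (@continuous_cos R)).
rewrite cos0 !subr0 => /eqP; rewrite subr_eq => /eqP ->.
by rewrite mulNr [leRHS]addrC lerD2l lerN2 ler_piMl// sin_le1.
Qed.

(** By sum-to-product, the difference of sines is 2 cos(x + y) sin x and the sum of cosines is 2
    cos(x + y) cos x. This removes the cotangent from differences of sine sums. *)
Lemma cot_mul_sinB x y : sin x != 0 ->
  cot x * (sin (x *+ 2 + y) - sin y) = cos (x *+ 2 + y) + cos y.
Proof.
move=> s0; rewrite sinD (cosD (x *+ 2) y) sin_mulr2n cos_mulr2n /cot.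
have e := cos2Dsin2 x.
transitivity (cos x ^+ 2 *+ 2 * cos y - cos x / sin x * (2 - cos x ^+ 2 *+ 2) * sin y).
  by field.
rewrite (_ : 2 - cos x ^+ 2 *+ 2 = sin x ^+ 2 *+ 2); last by rewrite !mulr2n; lra.
by field.
Qed.

Lemma sum_antisym_eq0 (q : nat) (f : nat -> R) :
  (forall j, (0 < j < q)%N -> f (q - j)%N = - f j) ->
  \sum_(1 <= j < q) f j = 0.
Proof.
move=> fN; suff : \sum_(1 <= j < q) f j = - \sum_(1 <= j < q) f j by lra.
rewrite {1}big_nat_rev/= -sumrN; apply: eq_big_nat => j jq.
by rewrite add1n subSS fN.
Qed.

(** The reflection j -> q - j exchanges the two halves; its fixed point j = q/2 is the reason for
    the vanishing hypothesis, which holds for cotangents. *)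
Lemma sum_sym_fold (q : nat) (f : nat -> R) :
  (forall j, (0 < j < q)%N -> f (q - j)%N = f j) ->
  (forall j, (j.*2 = q)%N -> f j = 0) ->
  \sum_(1 <= j < q) f j = 2 * \sum_(1 <= j < q | (j.*2 < q)%N) f j.
Proof.
move=> fS f0; rewrite (bigID (fun j => (j.*2 < q)%N))/= mulr_natl mulr2n; congr (_ + _).
rewrite (bigID (fun j => (j.*2 == q)%N))/= big1 => [|j /andP[_ /eqP/f0//]].
rewrite add0r [LHS]big_nat_rev/=.
rewrite [LHS]big_nat_cond [RHS]big_nat_cond; apply: eq_big => j.
  by rewrite add1n subSS; apply/idP/idP; lia.
by case/andP=> jq _; rewrite add1n subSS fS.
Qed.

End Trigonometry.

(** * Cotangents and characters at multiples of pi/q *)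

Section RootOfUnity.
Variables (R : realType) (q : nat).
Hypothesis q0 : (0 < q)%N.

(** Half the argument of e(n/q): cotangents are taken at [ang n], characters at [ang n *+ 2]. *)
Definition ang (n : nat) : R := pi * n%:R / q%:R.

Let qR : (q%:R : R) != 0. Proof. by rewrite pnatr_eq0 -lt0n. Qed.

Lemma angE n : ang n = pi * n%:R / q%:R. Proof. by []. Qed.

Lemma angD m n : ang (m + n) = ang m + ang n.
Proof. by rewrite /ang natrD mulrDr mulrDl. Qed.

Lemma angMq k : ang (q * k) = pi *+ k.
Proof. by rewrite /ang natrM mulrCA mulrAC mulfV// mul1r mulr_natr. Qed.

Lemma ang0 : ang 0 = 0. Proof. by rewrite /ang mulr0 mul0r. Qed.

Lemma sin_ang_gt0 n : (0 < n < q)%N -> 0 < sin (ang n).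
Proof.
case/andP=> n0 nq; apply: sin_gt0_pi; rewrite /ang.
rewrite divr_gt0 ?mulr_gt0 ?pi_gt0 ?ltr0n//=.
by rewrite ltr_pdivrMr ?ltr0n// ltr_pM2l ?pi_gt0// ltr_nat.
Qed.

Definition sin2 n := sin (ang n *+ 2).
Definition cos2 n := cos (ang n *+ 2).

Lemma ang2Mq n k : ang (n + q * k) *+ 2 = ang n *+ 2 + (pi *+ 2) *+ k.
Proof. by rewrite angD angMq mulrnDl mulrnAC. Qed.

Lemma sin2Mq n k : sin2 (n + q * k) = sin2 n.
Proof. by rewrite /sin2 ang2Mq (periodicn (@sinD2pi R)). Qed.

Lemma cos2Mq n k : cos2 (n + q * k) = cos2 n.
Proof. by rewrite /cos2 ang2Mq (periodicn (@cosD2pi R)). Qed.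

Lemma sin2_mod n : sin2 (n %% q) = sin2 n.
Proof. by rewrite [in RHS](divn_eq n q) addnC mulnC sin2Mq. Qed.

Lemma sin2_0 : sin2 0 = 0. Proof. by rewrite /sin2 ang0 mul0rn sin0. Qed.

Lemma sin2N m n k : (m + n = q * k)%N -> sin2 m = - sin2 n.
Proof.
move=> mn; have e : ang m *+ 2 = - (ang n *+ 2) + (pi *+ 2) *+ k.
  have -> : ang m = pi *+ k - ang n by rewrite -angMq -mn angD addrK.
  by rewrite mulrnBl addrC mulrnAC.
by rewrite /sin2 e (periodicn (@sinD2pi R)) sinN.
Qed.

Lemma cot_angDq n : cot (ang (n + q)) = cot (ang n).
Proof.
by rewrite angD -[in ang q](muln1 q) angMq mulr1n /cot sinDpi cosDpi invrN mulrNN.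
Qed.

Lemma cot_ang_mod n : cot (ang (n %% q)) = cot (ang n).
Proof.
rewrite [in RHS](divn_eq n q) addnC; elim: (n %/ q)%N => [|k IH]; first by rewrite addn0.
by rewrite mulSn addnCA addnC cot_angDq.
Qed.

Lemma cot_angN j : (j <= q)%N -> cot (ang (q - j)) = - cot (ang j).
Proof.
move=> jq; have e : ang (q - j) = pi - ang j.
  have : ang (q - j) + ang j = pi by rewrite -angD subnK// -(muln1 q) angMq.
  by move<-; rewrite addrK.
rewrite e /cot cosB sinB cospi sinpi !mul0r addr0 sub0r.
by rewrite !mulN1r opprK mulNr.
Qed.

(** Division by zero gives 0, so the pole gets the value 0 and cotangent sums may include the
    residue 0. *)
Lemma cot_ang0 : cot (ang 0) = 0.
Proof. by rewrite /cot ang0 sin0 invr0 mulr0. Qed.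

Lemma cot_ang_half j : (j.*2 = q)%N -> cot (ang j) = 0.
Proof.
move=> jq; have : cot (ang (q - j)) = - cot (ang j) by rewrite cot_angN//; lia.
by rewrite (_ : q - j = j)%N; [lra|lia].
Qed.

Lemma cot_ang_ge0 j : (j.*2 < q)%N -> 0 <= cot (ang j).
Proof.
move=> jq; case: j jq => [|j] jq; first by rewrite cot_ang0.
rewrite /cot divr_ge0//; last by apply/ltW/sin_ang_gt0; lia.
apply: cos_ge0_pihalf; rewrite /ang.
have q0R : 0 < (q%:R : R) by rewrite ltr0n.
have jqR : (2 * j.+1%:R < (q%:R : R)) by rewrite -natrM ltr_nat mul2n.
apply/andP; split.
  by apply: (@le_trans _ _ 0); rewrite ?divr_ge0 ?mulr_ge0 ?pi_ge0//; have := pi_gt0 R; lra.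
by rewrite ler_pdivrMr// -mulrA ler_wpM2l ?pi_ge0//; lra.
Qed.

Definition omega : R[i] := (cos2 1 +i* sin2 1)%C.

Lemma omegaX n : omega ^+ n = (cos2 n +i* sin2 n)%C.
Proof.
elim: n => [|n IH]; first by rewrite expr0 /cos2 /sin2 ang0 mul0rn cos0 sin0.
rewrite exprS IH /omega /cos2 /sin2 (angD 1 n) mulrnDl.
move: (ang 1 *+ 2) (ang n *+ 2) => x y; rewrite cosD sinD.
by apply/eqP; rewrite eq_complex /=; apply/andP; split; apply/eqP; ring.
Qed.

Lemma omegaXq : omega ^+ q = 1.
Proof. by rewrite omegaX -(add0n q) -[in (0 + q)%N](muln1 q) cos2Mq sin2Mq /cos2 /sin2 ang0 mul0rn cos0 sin0. Qed.

Lemma omega_prim : q.-primitive_root omega.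
Proof.
apply/andP; split => //; apply/forallP => -[i iq] /=.
rewrite unity_rootE; case: (i.+1 =P q) => [->|iNq]; first by rewrite omegaXq eqxx.
(* A smaller order would give cos(2 theta) = 1, hence sin theta = 0, for some theta strictly between
   0 and pi. *)
apply/eqP; apply: negbTE; apply/eqP; rewrite omegaX => -[+ _].
rewrite /cos2 cos_mulr2n => c1; have s0 : 0 < sin (ang i.+1) by apply: sin_ang_gt0; lia.
have := cos2Dsin2 (ang i.+1); nra.
Qed.

Lemma omega_neq0 : omega != 0.
Proof. by rewrite -unitfE; apply/unitrPr; exists (omega ^+ q.-1); rewrite -exprS prednK// omegaXq. Qed.

Lemma sum_omega n : \sum_(0 <= h < q) omega ^+ (n * h) = (if (q %| n)%N then q%:R else 0).
Proof.
case: ifPn => qn.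
  have e : omega ^+ n = 1 by apply/eqP; rewrite -(prim_order_dvd omega_prim).
  under eq_bigr do rewrite exprM e expr1n.
  by rewrite sumr_const_nat subn0.
under eq_bigr do rewrite exprM.
have := subrX1 (omega ^+ n) q; rewrite exprAC omegaXq expr1n subrr.
move/esym/eqP; rewrite mulf_eq0 subr_eq0 -(prim_order_dvd omega_prim) (negbTE qn)/=.
by move/eqP => e; rewrite big_mkord.
Qed.

Lemma sum_cos2 n : \sum_(0 <= h < q) cos2 (n * h) = (if (q %| n)%N then q%:R else 0).
Proof.
have := congr1 (@complex.Re R) (sum_omega n); rewrite raddf_sum/=.
under eq_bigr do rewrite omegaX/=.
by move=> ->; case: ifP => // _; rewrite -(rmorph_nat (@real_complex R)).
Qed.

(** Fourier inversion of the sawtooth. When m grows by 1, the sum changes by two complete cosine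
    sums minus their terms at h = 0. A complete sum vanishes unless q divides the frequency, so the
    first increment is q - 2 and the later ones are -2. *)
Lemma sum_cot_sin2 m : (0 < m < q)%N ->
  \sum_(0 <= h < q) cot (ang h) * sin2 (h * m) = q%:R - 2 * m%:R.
Proof.
set S := fun m => \sum_(0 <= h < q) cot (ang h) * sin2 (h * m).
have S0 : S 0%N = 0 by rewrite /S big1// => h _; rewrite muln0 sin2_0 mulr0.
have step n : S n.+1 - S n = \sum_(0 <= h < q) cos2 (n.+1 * h) + \sum_(0 <= h < q) cos2 (n * h) - 2.
  rewrite /S -sumrB -big_split/= (big_ltn q0) [in RHS](big_ltn q0)/=.
  rewrite !muln0 mul0n sin2_0 !mulr0 subr0 add0r /cos2 ang0 mul0rn cos0.
  rewrite [RHS](_ : _ = \sum_(1 <= i < q) (cos (ang (n.+1 * i) *+ 2) + cos (ang (n * i) *+ 2))); last by ring.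
  apply: eq_big_nat => h hq; have s0 := sin_ang_gt0 hq.
  rewrite /sin2 mulnC mulSn angD (mulnC h n) mulrnDl.
  by rewrite -mulrBr cot_mul_sinB ?gt_eqF.
suff H : forall n, (n.+1 < q)%N -> S n.+1 = q%:R - 2 * n.+1%:R.
  by case: m => // m /andP[_ /H].
elim=> [|n IH] nq.
  have := step 0%N; rewrite S0 subr0 => ->; rewrite !sum_cos2 dvdn0 dvdn1.
  by rewrite ifN; [ring|lia].
have /eqP := step n.+1; rewrite subr_eq => /eqP ->; rewrite IH ?(ltnW nq)// !sum_cos2.
rewrite !ifN ?gtnNdvd// ?(ltnW nq)//; rewrite -[in RHS]natr1; ring.
Qed.

End RootOfUnity.

(** * The cotangent sum as a weighted divisor sum *)

Lemma sum_periodic_mul (V : nmodType) (q a : nat) (f : nat -> V) :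
  (0 < q)%N -> coprime a q -> (forall n, f (n %% q)%N = f n) ->
  \sum_(0 <= m < q) f (a * m)%N = \sum_(0 <= m < q) f m.
Proof.
move=> q0 aq fq; rewrite !big_mkord.
pose h (i : 'I_q) := Ordinal (ltn_pmod (a * i) q0).
have hinj : injective h.
  move=> i j [] /eqP; rewrite -!/(modn _ _).
  wlog ij : i j / (i <= j)%N.
    by move=> H; case: (leqP i j) => [/H//|/ltnW /H H']; rewrite eq_sym => /H'/esym.
  rewrite eq_sym eqn_mod_dvd ?leq_mul// -mulnBr Gauss_dvdr 1?coprime_sym// => qd.
  apply/val_inj/eqP => /=; rewrite eqn_leq ij/= -subn_eq0.
  by apply: contraTT qd => d0; rewrite gtnNdvd ?lt0n//; have := ltn_ord j; lia.
by rewrite [RHS](reindex_inj hinj)/=; apply: eq_bigr => i _; rewrite fq.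
Qed.

Section CotangentSum.
Variables (R : realType) (q : nat).
Hypothesis q1 : (1 < q)%N.
Let q0 : (0 < q)%N := ltnW q1.
Let qR : (q%:R : R) != 0. Proof. by rewrite pnatr_eq0 -lt0n. Qed.

Local Notation ang := (@ang R q).
Local Notation sin2 := (@sin2 R q).
Local Notation omega := (@omega R q).

(** Since the cotangents sum to 0, the weight -m/q may be replaced by (q - 2m)/(2q), which
    [sum_cot_sin2] expands into sines; then m -> b m moves the residue from the cotangent to the
    sine. *)
Lemma c0_cot_sum (a b : nat) : (a * b = 1 %[mod q])%N ->
  c0 a%:Z q = (2 * q%:R)^-1 * \sum_(0 <= j < q) \sum_(0 <= h < q)
    cot (ang j) * cot (ang h) * sin2 (j * h * b) :> R.
Proof.
move=> ab.
have : coprime (a * b) q by rewrite -coprime_modl ab coprime_modl coprime1n.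
rewrite coprimeMl => /andP[aq bq].
have cots0 : \sum_(0 <= m < q) cot (ang (m * a)) = 0.
  under eq_bigr do rewrite mulnC.
  rewrite (@sum_periodic_mul _ q a (fun n => cot (ang n)))// => [|n]; last exact: cot_ang_mod.
  rewrite big_ltn// cot_ang0 add0r; apply: sum_antisym_eq0 => j /andP[_ jq].
  by rewrite cot_angN// ltnW.
pose G m := (\sum_(0 <= h < q) cot (ang h) * sin2 (h * m)) * cot (ang (m * a)).
have Gq n : G (n %% q)%N = G n.
  rewrite /G; congr (_ * _); last by rewrite -cot_ang_mod// modnMml cot_ang_mod.
  by apply: eq_bigr => h _; rewrite -sin2_mod// modnMmr sin2_mod.
have -> : c0 a%:Z q = (2 * q%:R)^-1 * \sum_(0 <= m < q) G m.
  rewrite /c0; transitivity (- \sum_(1 <= m < q) (m%:R / q%:R) * cot (ang (m * a)) +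
     2^-1 * \sum_(0 <= m < q) cot (ang (m * a))).
    rewrite cots0 mulr0 addr0; congr (- _); apply: eq_bigr => m _.
    by rewrite /ang natrM mulrA -pmulrn.
  rewrite [X in _ + _ * X]big_ltn// [X in _ = _ * X]big_ltn//.
  have G0 : G 0%N = 0 by rewrite /G mul0n cot_ang0 mulr0.
  rewrite G0 mul0n cot_ang0 !add0r -sumrN !mulr_sumr -big_split/=.
  apply: eq_big_nat => m mq; rewrite /G sum_cot_sin2//.
  by field.
rewrite -(sum_periodic_mul q0 bq Gq); congr (_ * _).
apply: eq_bigr => m _; rewrite /G mulr_suml; apply: eq_bigr => h _.
have -> : cot (ang (b * m * a)) = cot (ang m).
  rewrite -cot_ang_mod// (_ : (b * m * a = a * b * m)%N); last by ring.
  by rewrite -modnMml ab modnMml mul1n cot_ang_mod.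
by rewrite mulrC mulrA (_ : (h * (b * m) = m * h * b)%N); last by ring.
Qed.

(* The ratio of [cot (pi j / q)] to its principal part, cut off at [q / 2]. *)
Definition cot_weight (j : nat) : R :=
  if (0 < j)%N && (j.*2 < q)%N then ang j * cot (ang j) else 0.

Definition divisor_weight (n : nat) : R :=
  \sum_(j <- divisors n) cot_weight j * cot_weight (n %/ j).

Lemma cot_weight_large j : (q <= j)%N -> cot_weight j = 0.
Proof. by move=> qj; rewrite /cot_weight ifN//; lia. Qed.

(** The summand is invariant under j -> q - j and h -> q - h, so both variables fold to below q/2
    with a factor 4; the prefactor is 4/(2q) times (q/pi)^2. *)
Lemma c0_weight_sum (a b : nat) : (a * b = 1 %[mod q])%N ->
  c0 a%:Z q = 2 * q%:R / pi ^+ 2 * \sum_(1 <= j < q) \sum_(1 <= h < q)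
    cot_weight j * cot_weight h / (j * h)%:R * sin2 (j * h * b) :> R.
Proof.
move=> /c0_cot_sum ->.
have pi0 : (pi : R) != 0 by rewrite gt_eqF ?pi_gt0.
pose T j h : R := cot (ang j) * cot (ang h) * sin2 (j * h * b).
have TN1 j h : (0 < j < q)%N -> T (q - j)%N h = T j h.
  move=> jq; rewrite /T cot_angN//; last by lia.
  rewrite (_ : sin2 ((q - j) * h * b) = - sin2 (j * h * b)); first by ring.
  by apply: (@sin2N _ _ q0 _ _ (h * b)); nia.
have TC j h : T j h = T h j by rewrite /T (mulrC (cot _)) (mulnC j).
have T0 j : T j 0%N = 0 by rewrite /T cot_ang0 mulr0 mul0r.
have Thalf j h : (h.*2 = q)%N -> T j h = 0 by move=> hq; rewrite /T (cot_ang_half R q0 hq) mulr0 mul0r.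
have TN2 j h : (0 < h < q)%N -> T j (q - h)%N = T j h by move=> hq; rewrite TC TN1// TC.
have -> : \sum_(0 <= j < q) \sum_(0 <= h < q) T j h =
    4 * \sum_(1 <= j < q | (j.*2 < q)%N) \sum_(1 <= h < q | (h.*2 < q)%N) T j h.
  have inner j : \sum_(0 <= h < q) T j h = 2 * \sum_(1 <= h < q | (h.*2 < q)%N) T j h.
    rewrite big_ltn// T0 add0r; apply: sum_sym_fold => h hq; first exact: TN2.
    exact: Thalf.
  under eq_bigr do rewrite inner.
  rewrite -mulr_sumr big_ltn// big1 => [|h _]; last by rewrite TC T0.
  rewrite add0r sum_sym_fold.
  - by rewrite mulrA -natrM.
  - by move=> j jq; apply: eq_bigr => h _; exact: TN1.
  - by move=> j jq; apply: big1 => h _; rewrite TC Thalf.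
rewrite big_mkcond/= !mulr_sumr; apply: eq_big_nat => j jq.
case: ifPn => jq2; last first.
  by rewrite !mulr0 big1 ?mulr0// => h _; rewrite {1}/cot_weight (negbTE jq2) andbF !mul0r.
rewrite big_mkcond/= !mulr_sumr; apply: eq_big_nat => h hq.
case: ifPn => hq2; last first.
  by rewrite !mulr0 [cot_weight h]/cot_weight (negbTE hq2) andbF mulr0 !mul0r mulr0.
rewrite /cot_weight jq2 hq2; case/andP: (jq) => -> _; case/andP: (hq) => -> _ /=.
have j0 : (j%:R : R) != 0 by rewrite pnatr_eq0 -lt0n; case/andP: jq => ->.
have h0 : (h%:R : R) != 0 by rewrite pnatr_eq0 -lt0n; case/andP: hq => ->.
rewrite /T; move: (cot (ang j)) (cot (ang h)) (sin2 _) => c c' t.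
rewrite !angE natrM; move: (pi : R) pi0 => p p0; field.
by rewrite h0 j0 qR p0.
Qed.

(** Every product j h with j, h < q is at most [N], and the weights vanish from q on, so grouping by
    n = j h up to [N] neither loses nor adds terms. *)
Lemma divisor_weight_sum (N b : nat) : (q ^ 2 <= N)%N ->
  \sum_(1 <= j < q) \sum_(1 <= h < q)
    cot_weight j * cot_weight h / (j * h)%:R * sin2 (j * h * b) =
  \sum_(1 <= n < N.+1) divisor_weight n / n%:R * sin2 (n * b).
Proof.
move=> qN.
pose F j h : R := cot_weight j * cot_weight h / (j * h)%:R * sin2 (j * h * b).
transitivity (\sum_(1 <= n < N.+1) \sum_(j <- divisors n) F j (n %/ j)%N); last first.
  apply: eq_big_nat => n /andP[n0 _].
  rewrite /divisor_weight !mulr_suml big_seq [RHS]big_seq; apply: eq_bigr => j.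
  by rewrite -dvdn_divisors// => jn; rewrite /F mulnC divnK.
rewrite sum_divisors_swap.
have qN1 : (q <= N.+1)%N by apply: leqW; apply: leq_trans qN; rewrite leq_pmulr.
rewrite [RHS](big_cat_nat (n := q))//= [X in _ = _ + X]big_nat [X in _ = _ + X]big1 ?addr0; last first.
  by move=> j /andP[qj _]; apply: big1 => h _; rewrite /F cot_weight_large// !mul0r.
apply: eq_big_nat => j jq; rewrite [RHS]big_mkcond/=.
rewrite [RHS](big_cat_nat (n := q))//= [X in _ = _ + X]big_nat [X in _ = _ + X]big1 ?addr0; last first.
  by move=> h /andP[qh _]; rewrite /F (cot_weight_large qh) mulr0 !mul0r if_same.
apply: eq_big_nat => h hq; rewrite ifT//; apply: leq_trans qN.
by rewrite expnS expn1 leq_mul//; lia.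
Qed.

Lemma cot_weight_ge0 j : 0 <= cot_weight j.
Proof.
rewrite /cot_weight; case: ifP => // /andP[j0 jq]; rewrite mulr_ge0 ?cot_ang_ge0//.
by rewrite /ang divr_ge0 ?mulr_ge0 ?pi_ge0.
Qed.

Let ang_itv j : (0 < j)%N -> (j.*2 < q)%N -> 0 < ang j <= pi.
Proof.
move=> j0 jq; rewrite angE divr_gt0 ?mulr_gt0 ?pi_gt0 ?ltr0n//= ler_pdivrMr ?ltr0n//.
by rewrite ler_pM2l ?pi_gt0// ler_nat; lia.
Qed.

Lemma cot_weight_le1 j : cot_weight j <= 1.
Proof.
rewrite /cot_weight; case: ifP => // /andP[j0 jq].
have /andP[a0 api] := ang_itv j0 jq.
have s0 : 0 < sin (ang j) by apply: sin_ang_gt0 => //; lia.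
by rewrite /cot mulrA ler_pdivrMr// mul1r xcosx_le_sinx// (ltW a0).
Qed.

(** With x = pi j/q, x cot x >= cos x >= 1 - x and pi < 4; for j >= q/2 the left side is not
    positive. *)
Lemma cot_weight_ge j : (0 < j)%N -> 1 - 4 * j%:R / q%:R <= cot_weight j.
Proof.
move=> j0; have q0R : 0 < (q%:R : R) by rewrite ltr0n.
rewrite /cot_weight j0/=; case: ifPn => [jq|]; last first.
  rewrite -leqNgt -(ler_nat R) -muln2 natrM => jq.
  by rewrite subr_le0 ler_pdivlMr// mul1r; apply: le_trans jq _; rewrite mulrC ler_wpM2r// ler_nat.
have /andP[a0 api] := ang_itv j0 jq.
have s0 : 0 < sin (ang j) by apply: sin_ang_gt0 => //; lia.
have c0 : 0 <= cos (ang j).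
  have := cot_ang_ge0 R q0 jq; rewrite /cot => c.
  by rewrite -(divfK (lt0r_neq0 s0) (cos (ang j))) mulr_ge0// ltW.
apply: (@le_trans _ _ (cos (ang j))).
  apply: le_trans _ (cosx_ge1Nx (ltW a0)); rewrite lerD2l lerN2 angE.
  rewrite ler_pM2r ?invr_gt0// ler_wpM2r//; have := pihalf_lt2 R; lra.
by rewrite /cot mulrCA ler_peMr// ler_pdivlMr// mul1r sinx_le_x// ltW.
Qed.

Lemma divisor_weight_ge0 n : 0 <= divisor_weight n.
Proof. by apply: sumr_ge0 => j _; rewrite mulr_ge0 ?cot_weight_ge0. Qed.

Lemma divisor_weight_le n : divisor_weight n <= (num_divisors n)%:R.
Proof.
rewrite /num_divisors -sum1_size natr_sum; apply: ler_sum => j _.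
by rewrite mulr_ile1 ?cot_weight_ge0 ?cot_weight_le1.
Qed.

(** For n = j h, 1 - w(j) w(h) <= (1 - w(j)) + (1 - w(h)) <= 4 (j + h)/q, and j, h <= n. *)
Lemma divisor_weight_ge n : (0 < n)%N ->
  (num_divisors n)%:R - divisor_weight n <= 8 * n%:R / q%:R * (num_divisors n)%:R.
Proof.
move=> n0; have q0R : 0 < (q%:R : R) by rewrite ltr0n.
rewrite /num_divisors -sum1_size natr_sum -sumrB mulr_sumr.
rewrite big_seq [leRHS]big_seq; apply: ler_sum => j.
rewrite -dvdn_divisors// => jn; rewrite mulr1.
have j0 := dvdn_gt0 n0 jn.
have h0 : (0 < n %/ j)%N by rewrite divn_gt0// dvdn_leq.
have := cot_weight_ge j0; have := cot_weight_ge h0.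
have := cot_weight_ge0 j; have := cot_weight_ge0 (n %/ j).
have := cot_weight_le1 j; have := cot_weight_le1 (n %/ j).
have jle : (j%:R : R) <= n%:R by rewrite ler_nat dvdn_leq.
have hle : ((n %/ j)%:R : R) <= n%:R by rewrite ler_nat leq_div.
rewrite ![4 * _ / _]mulrAC ![8 * _ / _]mulrAC.
set w := cot_weight _; set w' := cot_weight _.
have k0 : 0 < 4 / q%:R :> R by rewrite divr_gt0.
have -> : 8 / q%:R = 2 * (4 / q%:R) :> R by field.
move: (4 / q%:R) k0 => k k0 *; nra.
Qed.

End CotangentSum.

(** * Expansion of the moments *)

(** Encodes the nonzero integers of absolute value at most [N] by a finite type, so that tuples
    become finite functions and powers of sums expand over them. *)
Definition signed_index (N : nat) (x : bool * 'I_N) : int :=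
  if x.1 then (x.2.+1)%:Z else - (x.2.+1)%:Z.

Lemma abs_signed_index (N : nat) (x : bool * 'I_N) : `|signed_index x|%N = x.2.+1.
Proof. by rewrite /signed_index; case: ifP; rewrite ?abszN absz_nat. Qed.

Lemma signed_index_neq0 (N : nat) (x : bool * 'I_N) : signed_index x != 0.
Proof. by rewrite -absz_eq0 abs_signed_index. Qed.

Lemma signed_index_inj (N : nat) : injective (@signed_index N).
Proof.
move=> x y xy; have /eqP := congr1 absz xy; rewrite !abs_signed_index eqSS => /eqP/val_inj e2.
case: x y xy e2 => [s l] [s' l'] /= xy e; rewrite {l}e in xy *; congr (_, _).
by move: xy; rewrite /signed_index/=; case: s; case: s' => //= ?; lia.
Qed.

Lemma sum_signed_index (V : nmodType) (N : nat) (F : bool * 'I_N -> V) :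
  \sum_x F x = \sum_(l < N) (F (true, l) + F (false, l)).
Proof.
rewrite (eq_bigr (fun x => F (x.1, x.2))) => [|[]//].
rewrite -(pair_bigA _ (fun s l => F (s, l)))/= big_bool -big_split/=.
by apply: eq_bigr.
Qed.

(** Inversion permutes the units mod q; for q > 1 neither endpoint, a = q or b = 0, is a unit. *)
Lemma sum_coprime_inv (V : nmodType) (q : nat) (F G : nat -> V) : (1 < q)%N ->
  (forall a b, (a * b = 1 %[mod q])%N -> F a = G b) ->
  \sum_(1 <= a < q.+1 | coprime a q) F a = \sum_(0 <= b < q | coprime b q) G b.
Proof.
move=> q1 FG; have q0 := ltnW q1.
have -> : \sum_(1 <= a < q.+1 | coprime a q) F a = \sum_(0 <= a < q | coprime a q) F a.
  rewrite big_mkcond big_nat_recr//= [RHS]big_mkcond [RHS]big_ltn//=.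
  by rewrite /coprime gcdnn gcd0n gtn_eqF// addr0 add0r.
pose isinv (i j : 'I_q) := (i * j == 1 %[mod q])%N.
(* The default [i] makes [h] fix the non-units, so that it is an involution of all residues. *)
pose h (i : 'I_q) : 'I_q := odflt i [pick j | isinv i j].
have isinvP (i : 'I_q) : coprime i q -> exists j, isinv i j.
  move=> iq; exists (Ordinal (ltn_pmod (i ^ (totient q).-1) q0)).
  rewrite /isinv /= modnMmr -expnS prednK ?totient_gt0//.
  by rewrite Euler_exp_totient.
have isinvC i j : isinv i j = isinv j i by rewrite /isinv mulnC.
have isinv_cop (i j : 'I_q) : isinv i j -> coprime i q.
  move=> /eqP e; have : coprime (i * j) q by rewrite -coprime_modl e coprime_modl coprime1n.
  by rewrite coprimeMl => /andP[].
have isinv_uniq i j k : isinv i j -> isinv i k -> j = k.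
  move=> /eqP ij /eqP ik; apply: val_inj; rewrite /= -(modn_small (ltn_ord j)) -(modn_small (ltn_ord k)).
  rewrite -[in LHS](mul1n j) -[in LHS]modnMml -ik modnMml.
  by rewrite mulnAC -modnMml ij modnMml mul1n.
have hP (i : 'I_q) : coprime i q -> isinv i (h i).
  by move=> /isinvP[j ij]; rewrite /h; case: pickP => [//|/(_ j)]; rewrite ij.
have hN (i : 'I_q) : ~~ coprime i q -> h i = i.
  by move=> iq; rewrite /h; case: pickP => // j /isinv_cop; rewrite (negbTE iq).
have hc (i : 'I_q) : coprime (h i) q = coprime i q.
  have [iq|iq] := boolP (coprime i q); last by rewrite hN// (negbTE iq).
  by have := hP _ iq; rewrite isinvC => /isinv_cop.
have hK : involutive h.
  move=> i; have [iq|iq] := boolP (coprime i q); last by rewrite !hN.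
  by apply: (@isinv_uniq (h i)); [rewrite hP ?hc|rewrite isinvC hP].
rewrite !big_mkord [RHS](reindex_inj (inv_inj hK))/=.
apply: eq_big => [i|i iq]; first by rewrite hc.
by apply: FG; apply/eqP; exact: hP.
Qed.

Lemma sum_dvdn (V : nmodType) (q m : nat) (F : nat -> V) : (0 < q)%N -> (m %| q)%N ->
  \sum_(0 <= b < q | (m %| b)%N) F b = \sum_(0 <= b < q %/ m) F (m * b)%N.
Proof.
move=> q0 mq; have m0 := dvdn_gt0 q0 mq.
rewrite -[LHS]big_filter -[RHS](big_map (muln m) xpredT).
apply: perm_big; apply: uniq_perm.
- by rewrite filter_uniq// iota_uniq.
- rewrite map_inj_uniq ?iota_uniq// => x y /eqP.
  by rewrite eqn_pmul2l// => /eqP.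
- move=> b; rewrite mem_filter mem_index_iota; apply/idP/mapP.
  + case/and3P=> /dvdnP[c ->] _ cq; exists c; last by rewrite mulnC.
    by rewrite mem_index_iota ltn_divRL.
  + by case=> c; rewrite mem_index_iota ltn_divRL// => cq ->; rewrite dvdn_mulr//= mulnC.
Qed.

Section Moments.
Variables (R : realType) (q : nat).
Hypothesis q1 : (1 < q)%N.
Let q0 : (0 < q)%N := ltnW q1.

Local Notation omega := (@omega R q).

Definition alpha (N : nat) (x : bool * 'I_N) : R :=
  divisor_weight R q `|signed_index x| / (signed_index x)%:~R.

(** The terms of n and -n pair up to e(n b/q) - e(-n b/q) = 2 i sin(2 pi n b/q), and 2 i times q/(i
    pi^2) is the earlier factor 2q/pi^2. *)
Lemma c0_omega (a b N : nat) : (q ^ 2 <= N)%N -> (a * b = 1 %[mod q])%N ->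
  (c0 a%:Z q)%:C%C = q%:R / ('i * (pi ^+ 2)%:C)%C *
    \sum_(x : bool * 'I_N) (alpha x)%:C%C * omega ^ (signed_index x * b%:Z) :> R[i].
Proof.
move=> qN ab; rewrite (c0_weight_sum R q1 ab) (divisor_weight_sum R q1 b qN).
rewrite big_add1 big_mkord sum_signed_index.
have om n : omega ^+ n - omega ^- n = (2 * 'i * (sin2 R q n)%:C)%C.
  have e : omega ^+ n * (cos2 R q n -i* sin2 R q n)%C = 1.
    rewrite omegaX//; apply/eqP; rewrite eq_complex/=; apply/andP; split; apply/eqP.
      by rewrite mulrN opprK -!expr2 cos2Dsin2.
    by rewrite mulrN mulrC addNr.
  rewrite (mulr1_eq e) omegaX//.
  by apply/eqP; rewrite eq_complex/=; apply/andP; split; apply/eqP; ring.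
have : (pi ^+ 2 : R) != 0 by rewrite expf_neq0// gt_eqF ?pi_gt0.
move: (pi ^+ 2 : R) => p p0.
have pC0 : (p%:C)%C != 0 :> R[i] by rewrite eq_complex /= negb_and p0.
have i2 : ('i * 'i = -1 :> R[i])%C by rewrite -expr2 sqr_i.
have i0 : ('i%C : R[i]) != 0 by rewrite -unitfE; apply/unitrPr; exists (- 'i)%C; rewrite mulrN i2 opprK.
have -> : \sum_(l < N) ((alpha (true, l))%:C%C * omega ^ (signed_index (true, l) * b%:Z) +
   (alpha (false, l))%:C%C * omega ^ (signed_index (false, l) * b%:Z)) =
   (2 * 'i)%C * (\sum_(l < N) divisor_weight R q l.+1 / l.+1%:R * sin2 R q (l.+1 * b))%:C%C.
  rewrite raddf_sum mulr_sumr; apply: eq_bigr => l _.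
  have E1 : omega ^ (signed_index (true, l) * b%:Z) = omega ^+ (l.+1 * b).
    by rewrite /signed_index/= -PoszM -exprnP.
  have E2 : omega ^ (signed_index (false, l) * b%:Z) = omega ^- (l.+1 * b).
    by rewrite /signed_index/= mulNr -PoszM -exprnN.
  rewrite E1 E2 /alpha !abs_signed_index /signed_index /=.
  rewrite mulrNz invrN mulrN rmorphN/= mulNr -mulrBr om -pmulrn !rmorphM/=; ring.
rewrite !rmorphM/= mulrA; congr (_ * _).
rewrite fmorphV/= !rmorph_nat.
by field; rewrite i0 pC0.
Qed.

Definition ramanujan (h : int) : R[i] :=
  \sum_(0 <= b < q | coprime b q) omega ^ (h * b%:Z).

Lemma ramanujan0 : ramanujan 0 = (totient q)%:R.
Proof.
rewrite /ramanujan; under eq_bigr do rewrite mul0r expr0z.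
rewrite totient_count_coprime natr_sum [LHS]big_mkcond/=.
by apply: eq_bigr => b _; rewrite coprime_sym; case: ifP.
Qed.

(** After the sieve, the sum over b divisible by m is a geometric sum of length q/m in a (q/m)-th
    root of unity, equal to q/m or 0. *)
Lemma norm_ramanujan (h : int) :
  `|ramanujan h| <= \sum_(m <- divisors q) ((q %/ m) * ((q %/ m) %| `|h|))%:R.
Proof.
rewrite /ramanujan.
apply: le_trans (norm_sum_coprime _ _ q0) _.
rewrite big_seq [leRHS]big_seq; apply: ler_sum => m; rewrite -dvdn_divisors// => mq.
have m0 := dvdn_gt0 q0 mq.
rewrite sum_dvdn//; under eq_bigr do rewrite PoszM mulrA -exprz_exp.
have zq : (omega ^ (h * m)) ^+ (q %/ m) = 1.
  rewrite -exprz_exp -(exprnP (omega ^ h)) -exprM mulnC divnK//.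
  by rewrite (exprnP (omega ^ h)) exprz_exp mulrC -exprz_exp -exprnP omegaXq// exp1rz.
have z1 : (omega ^ (h * m) == 1) = (q %/ m %| `|h|)%N.
  have -> : (omega ^ (h * m) == 1) = (omega ^+ (`|h| * m) == 1).
    case: h {zq} => n; first by rewrite absz_nat.
    by rewrite NegzE mulNr -PoszM abszN absz_nat -exprnN invr_eq1.
  by rewrite -(prim_order_dvd (omega_prim R q0)) -{1}(divnK mq) dvdn_pmul2r.
case: (boolP (q %/ m %| `|h|)%N) z1 => [_ /eqP e|_ e].
  under eq_bigr do rewrite e exp1rz.
  by rewrite sumr_const_nat subn0 normr_nat muln1.
rewrite muln0 [X in `|X|](_ : _ = 0) ?normr0//.
have := subrX1 (omega ^ (h * m)) (q %/ m); rewrite zq subrr => /esym/eqP.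
by rewrite mulf_eq0 subr_eq0 e/= => /eqP; rewrite big_mkord.
Qed.

(** In the expanded k-th power, averaging over b turns each tuple into a Ramanujan sum at its total.
    At total 0 this is phi(q), which cancels the normalisation; the other tuples make up [E]. *)
Lemma moment_expansion (N k : nat) : (q ^ 2 <= N)%N ->
  exists E : R[i],
    ((totient q)%:R^-1 * \sum_(1 <= a < q.+1 | coprime a q) c0 a%:Z q ^+ k)%:C%C =
      q%:R ^+ k * ('i * (pi ^+ 2)%:C)%C ^- k *
      ((\sum_(f : {ffun 'I_k -> bool * 'I_N} | \sum_i signed_index (f i) == 0)
          \prod_i alpha (f i))%:C%C + E) /\
    `|E| <= ((totient q)%:R^-1 * \sum_(m <- divisors q)
      \sum_(f : {ffun 'I_k -> bool * 'I_N} | (\sum_i signed_index (f i) != 0) &&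
           (q %/ m %| `|(\sum_i signed_index (f i))%R|)%N)
          (q %/ m)%:R * \prod_i `|alpha (f i)|)%:C%C.
Proof.
move=> qN; set Phi : R := (totient q)%:R.
have phi0 : (0 < totient q)%N by rewrite totient_gt0.
have Phi0 : Phi != 0 by rewrite pnatr_eq0 -lt0n.
pose sg (f : {ffun 'I_k -> bool * 'I_N}) := \sum_i signed_index (f i).
exists (\sum_(f | sg f != 0) (\prod_i alpha (f i))%:C%C * (Phi^-1%:C%C * ramanujan (sg f))).
split.
  rewrite -/Phi rmorphM/= raddf_sum/=.
  set cst := q%:R / ('i * (pi ^+ 2)%:C)%C : R[i].
  rewrite (@sum_coprime_inv _ _ _ (fun b => cst ^+ k *
     \sum_(f : {ffun 'I_k -> bool * 'I_N}) (\prod_i alpha (f i))%:C%C * omega ^ (sg f * b%:Z)) q1); last first.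
    move=> a b ab; rewrite rmorphXn/= (c0_omega qN ab) exprMn; congr (_ * _).
    rewrite -[k in _ ^+ k]card_ord -prodr_const bigA_distr_bigA/=; apply: eq_bigr => f _.
    rewrite big_split/= rmorph_prod; congr (_ * _).
    rewrite /sg mulr_suml; elim/big_rec2: _ => [|i y z _ ->]; first by rewrite expr0z.
    by rewrite expfzDr ?omega_neq0.
  rewrite -mulr_sumr exchange_big/= mulrCA /cst expr_div_n; congr (_ * _).
  under eq_bigr do rewrite -mulr_sumr -/(ramanujan _).
  rewrite mulr_sumr (bigID (fun f => sg f == 0))/=; congr (_ + _).
    rewrite raddf_sum/=; apply: eq_bigr => f /eqP ->; rewrite ramanujan0.
    rewrite mulrCA (_ : _ * (totient q)%:R = 1) ?mulr1//.
    by rewrite -(rmorph_nat (@real_complex R)) -rmorphM/= mulVf.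
  by apply: eq_bigr => f _; rewrite mulrCA.
apply: le_trans (ler_norm_sum _ _ _) _.
rewrite mulr_sumr raddf_sum/=.
under [leRHS]eq_bigr do rewrite mulr_sumr raddf_sum big_mkcondr/=.
rewrite exchange_big/=; apply: ler_sum => f _.
have -> : \sum_(m <- divisors q) (if (q %/ m %| `|sg f|)%N then
    (Phi^-1 * ((q %/ m)%:R * \prod_i `|alpha (f i)|))%:C%C else 0) =
   (Phi^-1 * \prod_i `|alpha (f i)|)%:C%C * \sum_(m <- divisors q) ((q %/ m) * ((q %/ m) %| `|sg f|))%:R.
  rewrite mulr_sumr; apply: eq_bigr => m _; case: ifP => _; last by rewrite muln0 mulr0.
  by rewrite muln1 mulrCA mulrC rmorphM rmorph_nat.
rewrite !normrM mulrA mulrC [leRHS]mulrC; apply: ler_pM => //.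
  exact: norm_ramanujan.
rewrite mulrC rmorphM/=; apply: ler_pM => //.
  by rewrite ger0_norm// lecR invr_ge0.
by rewrite rmorph_prod normr_prod rmorph_prod/=; apply: ler_prod => i _; rewrite normr_ge0/= normc_def/= expr0n/= addr0 sqrtr_sqr.
Qed.

End Moments.

(** * Sums over tuples *)

Section Update.
Variables (k : nat) (T : finType).

Definition update (f : {ffun 'I_k -> T}) (i : 'I_k) (x : T) : {ffun 'I_k -> T} :=
  [ffun j => if j == i then x else f j].

Lemma updateE f i x : update f i x i = x.
Proof. by rewrite ffunE eqxx. Qed.

Lemma update_neq f i x j : j != i -> update f i x j = f j.
Proof. by rewrite ffunE => /negbTE ->. Qed.

(* The involution [(f, x) |-> (update f i x, f i)] frees the [i]-th coordinate. *)
Lemma sum_update (R : comPzRingType) (u : T -> R) (i : 'I_k) (F : {ffun 'I_k -> T} -> R) :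
  (\sum_x u x) * (\sum_f F f) = \sum_(f : {ffun 'I_k -> T}) \sum_x u (f i) * F (update f i x).
Proof.
rewrite mulr_suml; under eq_bigr do rewrite mulr_sumr.
rewrite exchange_big/= !pair_bigA/=.
pose h (p : {ffun 'I_k -> T} * T) := (update p.1 i p.2, p.1 i).
have hK : involutive h.
  move=> [f x]; rewrite /h/= updateE; congr (_, _); apply/ffunP => j.
  by rewrite ffunE; case: eqP => [->//|/eqP ji]; rewrite update_neq.
by rewrite (reindex_inj (inv_inj hK)).
Qed.

(** With all coordinates but the i-th fixed, the condition [P] constrains the i-th alone and costs
    [M]; the others then range freely. *)
Lemma sum_update_le (R : realFieldType) (u y : T -> R) (i : 'I_k)
    (P : pred {ffun 'I_k -> T}) (M : R) :
  (forall x, 0 <= u x) -> 0 < \sum_x u x ->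
  (forall f, \sum_(x | P (update f i x)) y x <= M) ->
  \sum_(f | P f) y (f i) * \prod_(j | j != i) u (f j) <= M * (\sum_x u x) ^+ k.-1.
Proof.
(* Multiplying by the positive total weight supplies a free i-th coordinate, as [sum_update]
   requires. *)
move=> u0 Z0 HM; rewrite -(ler_pM2l Z0).
have -> : (\sum_x u x) * (M * (\sum_x u x) ^+ k.-1) = \sum_(f : {ffun 'I_k -> T}) M * \prod_j u (f j).
  have k0 : (0 < k)%N by apply: leq_ltn_trans (ltn_ord i).
  rewrite mulrCA -exprS prednK// -mulr_sumr; congr (_ * _).
  by rewrite -[in LHS](card_ord k) -prodr_const bigA_distr_bigA.
rewrite [X in _ * X <= _]big_mkcond/= (sum_update _ i); apply: ler_sum => f _.
rewrite -mulr_sumr -big_mkcond/=.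
under eq_bigr => x _.
  rewrite updateE (eq_bigr (fun j => u (f j))) => [|j ji]; last by rewrite update_neq.
  over.
rewrite -mulr_suml mulrCA [in leRHS](bigD1 i)//=.
by rewrite ler_wpM2r// mulr_ge0// prodr_ge0.
Qed.

End Update.

Lemma ler_sum_cover (R : numDomainType) (I T : finType) (F : T -> R)
    (P : pred T) (Q : I -> pred T) :
  (forall x, 0 <= F x) -> (forall x, P x -> exists i, Q i x) ->
  \sum_(x | P x) F x <= \sum_i \sum_(x | Q i x) F x.
Proof.
move=> F0 PQ; under [leRHS]eq_bigr do rewrite big_mkcond/=.
rewrite exchange_big/= [leLHS]big_mkcond/=; apply: ler_sum => x _.
case: ifP => [/PQ[i Qi]|_]; last by apply: sumr_ge0 => i _; case: ifP.
by rewrite (bigD1 i)//= Qi lerDl; apply: sumr_ge0 => j _; case: ifP.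
Qed.

(** * Divisor sums, harmonic and zeta partial sums, differences of products *)

Section RealSums.
Variable R : realType.

Lemma sum_abs_signed_index (N : nat) (F : nat -> R) :
  \sum_(x : bool * 'I_N) F `|signed_index x|%N = 2 * \sum_(1 <= n < N.+1) F n.
Proof.
rewrite sum_signed_index big_add1 big_mkord mulr_sumr; apply: eq_bigr => l _.
by rewrite !abs_signed_index mulr_natl mulr2n.
Qed.

(** By complete multiplicativity the left side is the part j h <= [N] of the double sum of psi(j)
    psi(h). *)
Lemma sum_num_divisors_le (N : nat) (psi : nat -> R) :
  (forall j, 0 <= psi j) -> {morph psi : a b / (a * b)%N >-> a * b} ->
  \sum_(1 <= n < N.+1) (num_divisors n)%:R * psi n <= (\sum_(1 <= j < N.+1) psi j) ^+ 2.
Proof.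
move=> psi0 psiM.
have -> : \sum_(1 <= n < N.+1) (num_divisors n)%:R * psi n =
   \sum_(1 <= n < N.+1) \sum_(j <- divisors n) psi j * psi (n %/ j)%N.
  apply: eq_big_nat => n /andP[n0 _]; rewrite /num_divisors -sum1_size natr_sum mulr_suml.
  rewrite big_seq [RHS]big_seq; apply: eq_bigr => j; rewrite -dvdn_divisors// => jn.
  by rewrite mul1r -psiM mulnC divnK.
rewrite (sum_divisors_swap (fun j h => psi j * psi h)) expr2 mulr_suml.
apply: ler_sum => j _; rewrite mulr_sumr big_mkcond/=; apply: ler_sum => h _.
by case: ifP => // _; rewrite mulr_ge0.
Qed.

Lemma ln1B_le (n : nat) : (0 < n)%N -> ln (n%:R : R) - ln n.+1%:R <= - n.+1%:R^-1.
Proof.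
move=> n0; have p0 : 0 < (n%:R : R) by rewrite ltr0n.
have p1 : 0 < (n.+1%:R : R) by rewrite ltr0n.
rewrite -ln_div ?posrE//.
have -> : n%:R / n.+1%:R = 1 + - n.+1%:R^-1 :> R.
  by rewrite -natr1; field; rewrite natr1 gt_eqF.
by apply: le_ln1Dx; rewrite ltrN2 invf_lt1// ltr1n ltnS.
Qed.

Lemma harmonic_le (N : nat) : (0 < N)%N ->
  \sum_(1 <= j < N.+1) (j%:R^-1 : R) <= 1 + ln N%:R.
Proof.
elim: N => // -[|N] IH _; first by rewrite big_nat1 invr1 ln1 addr0.
rewrite big_nat_recr//=; apply: le_trans (lerD (IH isT) (lexx _)) _.
have := @ln1B_le N.+1 isT.
by move: (ln N.+1%:R) (ln N.+2%:R) (N.+2%:R^-1) => x y z; lra.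
Qed.

(** Comparison with the integral of x^(-1 - tau) in discrete form: the stronger bound 1 + (1 -
    N^(-tau))/tau is proved by induction. *)
Lemma zeta_le (tau : R) (N : nat) : 0 < tau ->
  \sum_(1 <= j < N.+1) (j%:R `^ (- (1 + tau)) : R) <= 1 + tau^-1.
Proof.
move=> t0; suff H : (0 < N)%N ->
    \sum_(1 <= j < N.+1) (j%:R `^ (- (1 + tau)) : R) <= 1 + tau^-1 * (1 - N%:R `^ (- tau)).
  case: (posnP N) => [->|/H]; first by rewrite big_geq// addr_ge0// invr_ge0 ltW.
  move=> le1; apply: le_trans le1 _; have p0 := powR_ge0 N%:R (- tau).
  have ti : 0 < tau^-1 by rewrite invr_gt0.
  nra.
elim: N => // -[|N] IH _; first by rewrite big_nat1 !powR1 subrr mulr0 addr0.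
rewrite big_nat_recr//=; apply: le_trans (lerD (IH isT) (lexx _)) _.
have n0 : 0 < (N.+1%:R : R) by rewrite ltr0n.
have n1 : 0 < (N.+2%:R : R) by rewrite ltr0n.
have -> : N.+1%:R `^ (- tau) = N.+2%:R `^ (- tau) * expR (- tau * (ln N.+1%:R - ln N.+2%:R)) :> R.
  by rewrite /powR !gt_eqF// -expRD -mulrDr addrC subrK.
have -> : N.+2%:R `^ (- (1 + tau)) = N.+2%:R `^ (- tau) * N.+2%:R^-1 :> R.
  by rewrite /powR gt_eqF// opprD mulrDl mulN1r expRD expRN lnK ?posrE// mulrC.
have e1 : 1 + tau * N.+2%:R^-1 <= expR (- tau * (ln N.+1%:R - ln N.+2%:R)).
  apply: le_trans (expR_ge1Dx _); rewrite lerD2l mulNr -mulrN ler_wpM2l ?(ltW t0)//.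
  by rewrite lerNr ln1B_le.
have := powR_ge0 (N.+2%:R : R) (- tau); move: (_ `^ _) (expR _) (N.+2%:R^-1) e1 => p e c e1 p0.
have : p * c <= tau^-1 * (p * e - p) by rewrite ler_pdivlMl//; nra.
lra.
Qed.

(** The factors are exchanged one at a time; 0 <= y <= x keeps every mixed product below the full
    product of the x. *)
Lemma prodr_sub_le (I : finType) (x y delta : I -> R) :
  (forall i, 0 <= y i <= x i) -> (forall i, x i - y i <= delta i * x i) ->
  (forall i, 0 <= delta i) ->
  \prod_i x i - \prod_i y i <= (\sum_i delta i) * \prod_i x i.
Proof.
move=> yx xd d0.
suff H (s : seq I) : \prod_(i <- s) x i - \prod_(i <- s) y i <=
    (\sum_(i <- s) delta i) * \prod_(i <- s) x i /\
    0 <= \prod_(i <- s) y i <= \prod_(i <- s) x i by case: (H (index_enum I)).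
elim: s => [|i s [IH /andP[Y0 YX]]]; first by rewrite !big_nil subrr mul0r lexx ler01.
rewrite !big_cons; have /andP[y0 yxi] := yx i; split; last by rewrite mulr_ge0//= ler_pM.
set X := \prod_(j <- s) x j in IH YX *; set Y := \prod_(j <- s) y j in IH Y0 YX *.
rewrite (_ : x i * X - y i * Y = (x i - y i) * X + y i * (X - Y)); last by ring.
rewrite [leRHS]mulrDl; apply: lerD; first by rewrite mulrA ler_wpM2r// (le_trans Y0).
by rewrite mulrCA ler_pM// subr_ge0.
Qed.

End RealSums.

(** * Error terms *)

Lemma sum_signed_update (k N : nat) (f : {ffun 'I_k -> bool * 'I_N}) (i : 'I_k) (x : bool * 'I_N) :
  \sum_j signed_index (update f i x j) =
  signed_index x + \sum_(j | j != i) signed_index (f j).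
Proof.
rewrite (bigD1 i)//= updateE; congr (_ + _); apply: eq_bigr => j ji.
by rewrite update_neq.
Qed.

Section ErrorTerms.
Variables (R : realType).

Lemma norm_signed_index (N : nat) (x : bool * 'I_N) :
  `|(signed_index x)%:~R| = `|signed_index x|%N%:R :> R.
Proof. by rewrite -intr_norm -abszE -pmulrn. Qed.

(** For [X] = q^2 this dominates the absolute value of [alpha], as d_w vanishes from q^2 on. *)
Definition trunc_weight (X N : nat) (x : bool * 'I_N) : R :=
  if (`|signed_index x| < X)%N
  then (num_divisors `|signed_index x|)%:R / `|signed_index x|%N%:R else 0.

Definition harmonic_sum (X : nat) : R := \sum_(1 <= j < X.+1) j%:R^-1.

Lemma harmonic_sum_ge0 X : 0 <= harmonic_sum X.
Proof. by apply: sumr_ge0 => j _; rewrite invr_ge0. Qed.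

Lemma trunc_weight_ge0 X N (x : bool * 'I_N) : 0 <= trunc_weight X x.
Proof. by rewrite /trunc_weight; case: ifP => // _; rewrite divr_ge0. Qed.

Lemma sum_trunc_weight_le X N : (X <= N)%N ->
  \sum_(x : bool * 'I_N) trunc_weight X x <= 2 * harmonic_sum X ^+ 2.
Proof.
move=> XN.
rewrite (sum_abs_signed_index _ (fun n => if (n < X)%N then (num_divisors n)%:R / n%:R else 0)).
rewrite ler_pM2l// (big_cat_nat (n := X.+1))//= [X in _ + X]big_nat [X in _ + X]big1 ?addr0; last first.
  by move=> n /andP[Xn _]; rewrite ltnNge (ltnW Xn).
apply: le_trans (sum_num_divisors_le _ (psi := fun j => j%:R^-1) _ _).
- by apply: ler_sum => n _; case: ifP => // _; rewrite mulr_ge0 ?invr_ge0.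
- by move=> j; rewrite invr_ge0.
- by move=> a b; rewrite natrM invfM.
Qed.

Lemma sum_trunc_weight_gt0 X N : (1 < X)%N -> (0 < N)%N ->
  0 < \sum_(x : bool * 'I_N) trunc_weight X x.
Proof.
move=> X1; case: N => // N _; rewrite (bigD1 (true, ord0))//=.
apply: ltr_pwDl; last by apply: sumr_ge0 => x _; exact: trunc_weight_ge0.
by rewrite /trunc_weight abs_signed_index/= X1 divr1 ltr0n.
Qed.

(** For each sign, every block of length g holds at most one n of the residue class, and g <= k n
    gives g (floor(n/g) + 1) <= (k + 1) n. So the 1/n add up to at most (k + 1)/g times a harmonic
    sum. *)
Lemma sum_progression_le (N X g k : nat) (D : R) (r : int) :
  (0 < g)%N -> 0 <= D -> (forall n, (0 < n < X)%N -> (num_divisors n)%:R <= D) ->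
  \sum_(x : bool * 'I_N | (g %| `|(signed_index x + r)%R|)%N && (g <= k * `|signed_index x|)%N)
     trunc_weight X x <= 2 * (D * k.+1%:R / g%:R * harmonic_sum X).
Proof.
move=> g0 D0 HD; have gR : 0 < (g%:R : R) by rewrite ltr0n.
pose C s (l : 'I_N) := [&& (g %| `|(signed_index (s, l) + r)%R|)%N, (g <= k * l.+1)%N & (l.+1 < X)%N].
(* The block number of n, shifted by 1 so that it can be inverted. *)
pose t (l : 'I_N) := (l.+1 %/ g).+1.
have tinj s : {in C s &, injective t}.
  move=> l l' /and3P[d1 _ _] /and3P[d2 _ _] [tt].
  suff : l.+1 = l'.+1 %[mod g].
    move=> mm; apply: val_inj; apply: succn_inj.
    by rewrite (divn_eq l.+1 g) tt mm -divn_eq.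
  have : (g%:Z %| (signed_index (s, l) + r) - (signed_index (s, l') + r))%Z.
    by apply: rpredB; rewrite dvdzE.
  rewrite opprD addrACA subrr addr0 -eqz_mod_dvd.
  rewrite /signed_index/=; case: s {d1 d2}.
    by rewrite !modz_nat => /eqP[].
  by rewrite eqz_mod_dvd opprK addrC -eqz_mod_dvd !modz_nat => /eqP[].
have side s : \sum_(l | C s l) trunc_weight X (s, l) <= D * k.+1%:R / g%:R * harmonic_sum X.
  apply: (@le_trans _ _ (\sum_(l | C s l) D * k.+1%:R / g%:R * (t l)%:R^-1)).
    apply: ler_sum => l /and3P[_ gk lX]; rewrite /trunc_weight abs_signed_index/= lX.
    rewrite -!mulrA ler_pM ?invr_ge0// ?HD//.
    rewrite mulrA ler_pdivlMr ?ltr0n// mulrC ler_pdivrMr ?ltr0n//.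
    rewrite mulrC mulrA ler_pdivlMr// -!natrM ler_nat /t mulSn mulnS.
    by rewrite addnC leq_add ?leq_divM// mulnC.
  rewrite -mulr_sumr ler_wpM2l ?divr_ge0 ?mulr_ge0//.
  have -> : \sum_(l | C s l) ((t l)%:R^-1 : R) =
     \sum_(j <- [seq t l | l <- [seq l <- index_enum 'I_N | C s l]]) j%:R^-1.
    by rewrite big_map big_filter.
  apply: ler_sum_subseq => //.
  - rewrite map_inj_in_uniq ?filter_uniq ?index_enum_uniq// => l l'.
    by rewrite !mem_filter => /andP[h1 _] /andP[h2 _]; apply: (@tinj s).
  - by rewrite iota_uniq.
  - move=> j /mapP[l + ->]; rewrite mem_filter => /andP[/and3P[_ _ lX] _].
    by rewrite mem_index_iota /t/= ltnS (leq_trans _ lX)// ltnS leq_div.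
rewrite big_mkcond sum_signed_index big_split/= mulr_natl mulr2n.
apply: lerD; [apply: le_trans (side true)|apply: le_trans (side false)];
  rewrite [leRHS]big_mkcond; apply: ler_sum => l _;
  rewrite /C /trunc_weight !abs_signed_index/=; case: (_ %| _)%N => //=;
  case: (g <= _)%N => //=; by case: ifP.
Qed.

Variable q : nat.
Hypothesis q1 : (1 < q)%N.
Let q0 : (0 < q)%N := ltnW q1.

Lemma divisor_weight_large n : (q ^ 2 <= n)%N -> divisor_weight R q n = 0.
Proof.
move=> qn; have n0 : (0 < n)%N by apply: leq_trans qn; rewrite expn_gt0 q0.
rewrite /divisor_weight big_seq; apply: big1 => j; rewrite -dvdn_divisors// => jn.
case: (leqP q j) => [qj|jq]; first by rewrite cot_weight_large// mul0r.
rewrite [X in _ * X]cot_weight_large ?mulr0// leqNgt; apply/negP => nq.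
by move: qn; rewrite -{1}(divnK jn) expnS expn1 leqNgt; move/negP; apply; nia.
Qed.

Lemma norm_alpha N (x : bool * 'I_N) :
  `|alpha R q x| = divisor_weight R q `|signed_index x| / `|signed_index x|%N%:R.
Proof. by rewrite /alpha normrM normfV norm_signed_index ger0_norm// divisor_weight_ge0. Qed.

Lemma norm_alpha_le N (x : bool * 'I_N) : `|alpha R q x| <= trunc_weight (q ^ 2) x.
Proof.
rewrite norm_alpha /trunc_weight; case: ltnP => [_|/divisor_weight_large ->]; last by rewrite mul0r.
by rewrite ler_wpM2r ?invr_ge0// divisor_weight_le.
Qed.

(** A nonzero total divisible by g has size at least g, so some coordinate has size at least g/k.
    Summing that coordinate over its progression mod g gains 1/g, which cancels the factor g. *)
Lemma nonzero_sum_error (N k g : nat) (D : R) : (q ^ 2 <= N)%N -> (0 < g)%N -> 0 <= D ->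
  (forall n, (0 < n < q ^ 2)%N -> (num_divisors n)%:R <= D) ->
  \sum_(f : {ffun 'I_k -> bool * 'I_N} | (\sum_i signed_index (f i) != 0) &&
       (g %| `|(\sum_i signed_index (f i))%R|)%N)
     g%:R * \prod_i `|alpha R q (f i)| <=
  2 * k%:R * k.+1%:R * D * harmonic_sum (q ^ 2) * (2 * harmonic_sum (q ^ 2) ^+ 2) ^+ k.-1.
Proof.
move=> qN g0 D0 HD; have gR : 0 < (g%:R : R) by rewrite ltr0n.
pose sg (f : {ffun 'I_k -> bool * 'I_N}) := \sum_i signed_index (f i).
have q21 : (1 < q ^ 2)%N by rewrite -(exp1n 2) ltn_sqr.
have N0 : (0 < N)%N by apply: leq_trans qN; exact: ltnW.
pose Q (i : 'I_k) (f : {ffun 'I_k -> bool * 'I_N}) :=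
  (g %| `|sg f|)%N && (g <= k * `|signed_index (f i)|)%N.
apply: le_trans (ler_sum_cover (Q := Q) _ _) _.
- by move=> f; rewrite mulr_ge0// prodr_ge0.
- move=> f /andP[s0 gs]; case: (boolP [exists i, Q i f]) => [/existsP//|].
  rewrite negb_exists => /forallP HQ; exfalso.
  have small i : (k * `|signed_index (f i)| < g)%N.
    by have := HQ i; rewrite /Q gs/= ltnNge.
  have gle : (g <= `|sg f|)%N by rewrite dvdn_leq// absz_gt0.
  have sgle : (`|sg f| <= \sum_i `|signed_index (f i)|)%N.
    rewrite /sg; elim/big_rec2: _ => // i y z _ zy.
    by move: (signed_index (f i) : int) (y : int) zy => a b; lia.
  have k0 : (0 < k)%N.
    by rewrite lt0n; apply: contraNneq s0 => k0; rewrite big1// => -[i ik]; exfalso; move: ik; rewrite k0.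
  have : (k * \sum_i `|signed_index (f i)| <= k * g.-1)%N.
    rewrite big_distrr/=; apply: (@leq_trans (\sum_(i < k) g.-1)).
      by apply: leq_sum => i _; rewrite -ltnS prednK.
    by rewrite sum_nat_const card_ord.
  rewrite leq_pmul2l// => H; have : (g <= g.-1)%N by lia.
  lia.
apply: (@le_trans _ _ (\sum_(i < k) 2 * k.+1%:R * D * harmonic_sum (q ^ 2) *
    (2 * harmonic_sum (q ^ 2) ^+ 2) ^+ k.-1)); last first.
  rewrite sumr_const card_ord -mulr_natl; move: ((2 * harmonic_sum (q ^ 2) ^+ 2) ^+ k.-1) (harmonic_sum (q ^ 2)) => z h.
  by rewrite le_eqVlt; apply/orP; left; apply/eqP; ring.
apply: ler_sum => i _.
rewrite -mulr_sumr.
apply: (@le_trans _ _ (g%:R * (2 * (D * k.+1%:R / g%:R * harmonic_sum (q ^ 2)) *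
    (\sum_(x : bool * 'I_N) trunc_weight (q ^ 2) x) ^+ k.-1))).
  rewrite ler_wpM2l//.
  have H := @sum_update_le k _ R (@trunc_weight (q ^ 2) N) (@trunc_weight (q ^ 2) N) i (Q i)
    (2 * (D * k.+1%:R / g%:R * harmonic_sum (q ^ 2))) (@trunc_weight_ge0 _ N)
    (sum_trunc_weight_gt0 q21 N0).
  apply: le_trans (H _).
  - apply: ler_sum => f _; rewrite (bigD1 i)//=.
    apply: ler_pM => //; first by rewrite prodr_ge0.
      exact: norm_alpha_le.
    by apply: ler_prod => j _; rewrite normr_ge0 norm_alpha_le.
  (* The other coordinates fix the shift [r], hence the residue class of the i-th one. *)
  - move=> f; apply: le_trans (@sum_progression_le N _ g k D (\sum_(j | j != i) signed_index (f j)) g0 D0 HD).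
    rewrite le_eqVlt; apply/orP; left; apply/eqP; apply: eq_bigl => x.
    by rewrite /Q /sg sum_signed_update updateE.
set h := harmonic_sum _; set Z := \sum_x _.
rewrite (_ : _ * _ = 2 * k.+1%:R * D * h * Z ^+ k.-1); last by field; rewrite gt_eqF.
rewrite ler_wpM2l ?mulr_ge0 ?harmonic_sum_ge0//.
rewrite lerXn2r ?nnegrE ?mulr_ge0 ?exprn_ge0 ?harmonic_sum_ge0//.
  by apply: sumr_ge0 => x _; exact: trunc_weight_ge0.
exact: sum_trunc_weight_le.
Qed.

(** The counterpart of [alpha] with the true divisor function; products of these are the terms of
    H_k. *)
Definition beta (N : nat) (x : bool * 'I_N) : R :=
  (num_divisors `|signed_index x|)%:R / (signed_index x)%:~R.

Lemma sum_rankin_le (N : nat) (tau : R) : 0 < tau ->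
  \sum_(x : bool * 'I_N) (num_divisors `|signed_index x|)%:R *
     `|signed_index x|%N%:R `^ (- (1 + tau)) <= 2 * (1 + tau^-1) ^+ 2.
Proof.
move=> t0; rewrite (sum_abs_signed_index _ (fun n => (num_divisors n)%:R * n%:R `^ (- (1 + tau)))).
rewrite ler_pM2l//; apply: le_trans (sum_num_divisors_le _ (psi := fun j => j%:R `^ (- (1 + tau))) _ _) _.
- by move=> j; rewrite powR_ge0.
- by move=> a b; rewrite natrM powRM.
rewrite lerXn2r ?nnegrE ?zeta_le// ?addr_ge0 ?invr_ge0 ?(ltW t0)//.
by apply: sumr_ge0 => j _; rewrite powR_ge0.
Qed.

(** The denominators agree, so only products of d and d_w are compared: 0 <= d_w <= d gives the
    bound 1, and [prodr_sub_le] with delta_i = 8 |n_i|/q gives the other. *)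
Lemma norm_prod_beta_sub_alpha (N k : nat) (f : {ffun 'I_k -> bool * 'I_N}) :
  `|\prod_i beta (f i) - \prod_i alpha R q (f i)| <=
    (\prod_i ((num_divisors `|signed_index (f i)|)%:R / `|signed_index (f i)|%N%:R)) *
    Num.min 1 (\sum_i 8 * `|signed_index (f i)|%N%:R / q%:R).
Proof.
set A := \prod_i ((num_divisors _)%:R / _); have qR : 0 < (q%:R : R) by rewrite ltr0n.
pose n i := `|signed_index (f i)|%N.
have n0 i : (0 < n i)%N by rewrite /n abs_signed_index.
pose x i : R := (num_divisors (n i))%:R; pose y i : R := divisor_weight R q (n i).
pose V : R := \prod_i (n i)%:R^-1.
have V0 : 0 <= V by apply: prodr_ge0 => i _; rewrite invr_ge0.
have -> : `|\prod_i beta (f i) - \prod_i alpha R q (f i)| = V * `|\prod_i x i - \prod_i y i|.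
  rewrite /beta /alpha !big_split/= -mulrBl normrM mulrC; congr (_ * _).
  by rewrite normr_prod; apply: eq_bigr => i _; rewrite normfV norm_signed_index.
have -> : A = V * \prod_i x i by rewrite /A big_split/= mulrC.
have yx i : 0 <= y i <= x i by rewrite /x /y divisor_weight_ge0 ?divisor_weight_le.
have pyx : 0 <= \prod_i y i <= \prod_i x i.
  rewrite prodr_ge0//= => [|i _]; last by case/andP: (yx i).
  by apply: ler_prod => i _.
case/andP: pyx => py pyx.
rewrite -mulrA ler_wpM2l// ger0_norm ?subr_ge0//.
rewrite minr_pMr ?prodr_ge0// mulr1 le_min gerBl py/= [leRHS]mulrC.
apply: (prodr_sub_le yx) => i; first exact: divisor_weight_ge.
by rewrite divr_ge0 ?mulr_ge0.
Qed.

Lemma zero_sum_error (N k : nat) (C eps sigma : R) : (0 < N)%N ->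
  0 <= C -> 0 < eps -> 0 < sigma -> eps + sigma <= 1 ->
  (forall n, (0 < n)%N -> (num_divisors n)%:R <= C * n%:R `^ eps) ->
  \sum_(f : {ffun 'I_k -> bool * 'I_N} | \sum_i signed_index (f i) == 0)
     `|\prod_i beta (f i) - \prod_i alpha R q (f i)| <=
  8 * k%:R ^+ 2 * C * q%:R `^ (- (1 - eps - sigma)) * (2 * (1 + k%:R / sigma) ^+ 2) ^+ k.-1.
Proof.
move=> N0 C0 e0 s0 es dC; have qR : 0 < (q%:R : R) by rewrite ltr0n.
case: (posnP k) => [k0|k0].
  subst k; rewrite big1 => [|f _]; last by rewrite !big_ord0 subrr normr0.
  by rewrite expr0n/= mulr0 !mul0r.
have kR : 0 < (k%:R : R) by rewrite ltr0n.
(* The decay sigma of the largest coordinate is split into k equal shares, fewer than k of which are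
   handed to the other coordinates. *)
pose tau := sigma / k%:R; have t0 : 0 < tau by rewrite divr_gt0.
pose u (x : bool * 'I_N) : R := (num_divisors `|signed_index x|)%:R *
     `|signed_index x|%N%:R `^ (- (1 + tau)).
have u0 x : 0 <= u x by rewrite mulr_ge0 ?powR_ge0.
have Z0 : 0 < \sum_x u x.
  case: N @u u0 N0 => // N u u0 _; rewrite (bigD1 (true, ord0))//=.
  apply: ltr_pwDl; last by apply: sumr_ge0.
  by rewrite /u abs_signed_index/= powR1 mulr1 ltr0n.
pose th := 1 - eps - sigma; have th0 : 0 <= th by rewrite /th; lra.
have th1 : th <= 1 by rewrite /th; lra.
pose K : R := 8 * k%:R * C * q%:R `^ (- th).
have K0 : 0 <= K by rewrite !mulr_ge0 ?powR_ge0// ltW.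
have bound (f : {ffun 'I_k -> bool * 'I_N}) : `|\prod_i beta (f i) - \prod_i alpha R q (f i)| <=
    \sum_(i < k) K * \prod_(j | j != i) u (f j).
  pose n i := `|signed_index (f i)|%N.
  have n0 i : (0 < n i)%N by rewrite /n abs_signed_index.
  have [i _ imax] := @arg_maxnP _ (Ordinal k0) xpredT n isT.
  rewrite [in leRHS](bigD1 i)//=; apply: ler_wpDr.
    by apply: sumr_ge0 => j _; rewrite mulr_ge0// prodr_ge0.
  apply: le_trans (norm_prod_beta_sub_alpha f) _.
  rewrite [X in X * _](bigD1 i)//= -/(n i); set M := n i in imax *.
  have jmax j : (n j <= M)%N by exact: imax.
  have M0 : 0 < (M%:R : R) by rewrite ltr0n n0.
  have M1 : 1 <= (M%:R : R) by rewrite ler1n n0.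
  pose r : R := M%:R / q%:R; have r0 : 0 < r by rewrite divr_gt0.
  (* Interpolation min(1, r) <= r^th for 0 <= th <= 1. *)
  have min_le : Num.min 1 (\sum_j 8 * `|signed_index (f j)|%N%:R / q%:R) <= 8 * k%:R * r `^ th.
    have k1 : 1 <= 8 * k%:R :> R by rewrite -natrM ler1n muln_gt0.
    rewrite ge_min; case: (lerP 1 r) => r1.
      apply/orP; left; apply: (le_trans k1); rewrite ler_peMr ?(le_trans ler01)//.
      by rewrite -[leLHS](powRr0 r) ler_powR.
    apply/orP; right; apply: (@le_trans _ _ (8 * k%:R * r)).
      have -> : 8 * k%:R * r = \sum_(j < k) 8 * r.
        by rewrite sumr_const card_ord -[RHS]mulr_natr mulrAC.
      apply: ler_sum => j _.
      by rewrite -mulrA ler_wpM2l// ler_pM2r ?invr_gt0// ler_nat jmax.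
    rewrite ler_wpM2l ?(le_trans ler01)//.
    by rewrite ger1_powR// r0 ltW.
  (* All n_j are at most [M], so n_j^(-tau) >= M^(-tau), and k - 1 factors M^(-tau) exceed
     M^(-sigma). *)
  have prodM : M%:R `^ (- sigma) <= \prod_(j < k | j != i) (n j)%:R `^ (- tau).
    apply: (@le_trans _ _ (\prod_(j < k | j != i) M%:R `^ (- tau))).
      rewrite prodr_const.
      have Mt : M%:R `^ (- tau) <= 1 by rewrite -[leRHS](powRr0 M%:R) ler_powR// oppr_le0 ltW.
      have -> : - sigma = (- tau) * k%:R by rewrite /tau mulNr divfK// gt_eqF.
      rewrite powRrM powR_mulrn ?powR_ge0//.
      apply: ler_wiXn2l; rewrite ?powR_ge0//.
      by rewrite -[leqRHS](card_ord k) max_card.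
    apply: ler_prod => j _; rewrite powR_ge0/=.
    rewrite !powRN lef_pV2 ?posrE ?powR_gt0 ?ltr0n ?n0//.
    by apply: ge0_ler_powR; rewrite ?nnegrE ?(ltW t0)// ler_nat jmax.
  have uE j : u (f j) = (num_divisors (n j))%:R / (n j)%:R * (n j)%:R `^ (- tau).
    have nj : 0 < ((n j)%:R : R) by rewrite ltr0n.
    by rewrite /u -/(n j) -mulrA /powR gt_eqF// opprD mulrDl mulN1r expRD expRN lnK ?posrE.
  under [in leRHS]eq_bigr do rewrite uE.
  rewrite [in leRHS]big_split/=.
  pose A : R := \prod_(j < k | j != i) ((num_divisors (n j))%:R / (n j)%:R).
  rewrite [X in _ * X * Num.min _ _](_ : _ = A)// -/A.
  have A0 : 0 <= A by apply: prodr_ge0 => j _; rewrite divr_ge0.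
  set B := \prod_(j < k | j != i) _ `^ _ in prodM *.
  have B0 : 0 <= B by apply: prodr_ge0 => j _; rewrite powR_ge0.
  have dM := dC M (n0 i).
  have rE : r `^ th = M%:R * M%:R `^ (- eps) * M%:R `^ (- sigma) * q%:R `^ (- th).
    rewrite /r powRM// ?invr_ge0//; congr (_ * _).
      rewrite /powR gt_eqF// -mulrA -expRD -[X in _ = X * _](lnK M0) -expRD; congr expR.
      by rewrite /th; ring.
    by rewrite -powR_inv1 ?ler0n// -powRrM mulN1r.
  apply: (@le_trans _ _ ((num_divisors M)%:R / M%:R * A * (8 * k%:R * r `^ th))).
    by rewrite ler_wpM2l// mulr_ge0// divr_ge0.
  rewrite rE /K.
  have -> : (num_divisors M)%:R / M%:R * A * (8 * k%:R * (M%:R * M%:R `^ (- eps) * M%:R `^ (- sigma) * q%:R `^ (- th)))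
    = 8 * k%:R * q%:R `^ (- th) * A * ((num_divisors M)%:R * M%:R `^ (- eps)) * M%:R `^ (- sigma).
    by field; rewrite gt_eqF.
  have -> : 8 * k%:R * C * q%:R `^ (- th) * (A * B) = 8 * k%:R * q%:R `^ (- th) * A * C * B by ring.
  have dC' : (num_divisors M)%:R * M%:R `^ (- eps) <= C.
    by rewrite powRN -ler_pdivlMr ?invrK ?invr_gt0 ?powR_gt0.
  have W0 : 0 <= 8 * k%:R * q%:R `^ (- th) * A by rewrite !mulr_ge0 ?powR_ge0// ltW.
  apply: ler_pM => //; rewrite ?mulr_ge0 ?powR_ge0//.
  by rewrite ler_wpM2l.
apply: le_trans (ler_sum _ (fun f _ => bound f)) _.
rewrite exchange_big/=.
apply: (@le_trans _ _ (\sum_(i < k) K * (2 * (1 + k%:R / sigma) ^+ 2) ^+ k.-1)); last first.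
  rewrite sumr_const card_ord -mulr_natl /K -/th.
  move: ((2 * (1 + k%:R / sigma) ^+ 2) ^+ k.-1) (q%:R `^ (- th)) => z p.
  by rewrite le_eqVlt; apply/orP; left; apply/eqP; ring.
apply: ler_sum => i _; rewrite -mulr_sumr ler_wpM2l//.
(* Weight 1 at i and the bound 1: a zero total determines n_i from the other coordinates. *)
have H := @sum_update_le k _ R u (fun=> 1) i (fun f => \sum_i signed_index (f i) == 0) 1 u0 Z0.
have {}H := H _.
apply: (@le_trans _ _ (1 * (\sum_x u x) ^+ k.-1)).
  apply: le_trans (H _) => [|f]; first by apply: ler_sum => f _; rewrite mul1r.
  rewrite sumr_const -[X in _ <= X]/(1%:R) ler_nat.
  apply/card_le1_eqP => x y xP yP.
  have /eqP ex : \sum_j signed_index (update f i x j) == 0 := xP.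
  have /eqP ey : \sum_j signed_index (update f i y j) == 0 := yP.
  apply: signed_index_inj; apply: (addIr (\sum_(j | j != i) signed_index (f j))).
  by rewrite -!sum_signed_update ex ey.
rewrite mul1r lerXn2r ?nnegrE ?(ltW Z0)// ?mulr_ge0 ?exprn_ge0 ?addr_ge0 ?divr_ge0 ?(ltW s0)//.
by have := sum_rankin_le N t0; rewrite /tau invf_div.
Qed.

End ErrorTerms.

(** * The unordered sum as a limit over boxes *)

Section BoxSums.
Variables (R : realType) (k : nat).
Local Open Scope classical_set_scope.

Definition index_tuple (N : nat) (f : {ffun 'I_k -> bool * 'I_N}) : k.-tuple int :=
  [tuple signed_index (f i) | i < k].

Lemma tnth_index_tuple (N : nat) (f : {ffun 'I_k -> bool * 'I_N}) i :
  tnth (index_tuple f) i = signed_index (f i).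
Proof. by rewrite tnth_mktuple. Qed.

Lemma index_tuple_inj (N : nat) : injective (@index_tuple N).
Proof.
move=> f g fg; apply/ffunP => i; apply: signed_index_inj.
by rewrite -!tnth_index_tuple fg.
Qed.

Definition box (N : nat) : seq (k.-tuple int) :=
  [seq index_tuple f | f : {ffun 'I_k -> bool * 'I_N} <- index_enum _ & \sum_i signed_index (f i) == 0].

Lemma box_uniq N : uniq (box N).
Proof.
by rewrite map_inj_uniq ?filter_uniq ?index_enum_uniq//; exact: index_tuple_inj.
Qed.

Lemma mem_box N t : t \in box N <->
  @zero_sum_tuples k t /\ forall i, (`|tnth t i| <= N)%N.
Proof.
split=> [/mapP[f]|[[t0 ts] tN]].
  rewrite mem_filter => /andP[/eqP fs _] ->; split; last first.
    by move=> i; rewrite tnth_index_tuple abs_signed_index.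
  split=> [i|]; first by rewrite tnth_index_tuple signed_index_neq0.
  by under eq_bigr do rewrite tnth_index_tuple.
have nth_lt i : (`|tnth t i|.-1 < N)%N by rewrite prednK ?absz_gt0.
pose f := [ffun i => (0 <= tnth t i, Ordinal (nth_lt i))] : {ffun 'I_k -> bool * 'I_N}.
have fE i : signed_index (f i) = tnth t i.
  rewrite /signed_index ffunE/= prednK ?absz_gt0//; have := t0 i.
  by case: (tnth t i) => n /=; rewrite ?NegzE; lia.
apply/mapP; exists f; last by apply: eq_from_tnth => i; rewrite tnth_index_tuple fE.
rewrite mem_filter mem_index_enum andbT; under eq_bigr do rewrite fE.
by apply/eqP.
Qed.

Lemma big_box (N : nat) (p : k.-tuple int -> R) :
  \sum_(t <- box N) p t =
  \sum_(f : {ffun 'I_k -> bool * 'I_N} | \sum_i signed_index (f i) == 0) p (index_tuple f).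
Proof. by rewrite big_map big_filter. Qed.

Lemma zero_sum_finite_box (s : seq (k.-tuple int)) : [set` s] `<=` @zero_sum_tuples k ->
  exists N0, forall N, (N0 <= N)%N -> {subset s <= box N}.
Proof.
move=> sD; exists (\max_(t <- s) \max_(i < k) `|tnth t i|%N) => N N0N t ts.
apply/mem_box; split; first exact: sD.
move=> i; apply: leq_trans N0N.
apply: leq_trans (leq_bigmax_seq _ ts isT).
exact: (leq_bigmax (F := fun i => `|tnth t i|%N)).
Qed.

(** The sum is a supremum over finite subsets; boxes are such subsets, and each finite subset lies
    in all large boxes, so box sums approach it from below. *)
Lemma esum_box (p : k.-tuple int -> R) (K : R) : (forall t, 0 <= p t) ->
  (forall N, \sum_(t <- box N) p t <= K) ->
  exists P : R, esum (@zero_sum_tuples k) (EFin \o p) = P%:E /\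
    forall eta : R, 0 < eta -> exists N0, forall N, (N0 <= N)%N ->
      P - eta <= \sum_(t <- box N) p t <= P.
Proof.
move=> p0 pK; set D := @zero_sum_tuples k.
have fsumE (s : seq (k.-tuple int)) : uniq s ->
    (\sum_(t \in [set` s]) (EFin \o p) t)%E = (\sum_(t <- s) p t)%:E.
  by move=> us; rewrite -fsbig_seq// sumEFin.
have boxD N : fsets D [set` box N].
  by split => [|t /mem_box[]//]; exact: finite_seq.
have fsetsP (F : set (k.-tuple int)) : fsets D F -> exists s, [/\ uniq s, F = [set` s] & [set` s] `<=` D].
  move=> [/finite_seqP[s ->] sD]; exists (undup s); split; rewrite ?undup_uniq//.
    by apply/seteqP; split=> t /=; rewrite mem_undup.
  by move=> t /=; rewrite mem_undup => /sD.
have eK : (esum D (EFin \o p) <= K%:E)%E.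
  apply: ge_ereal_sup => _ [F /fsetsP[s [us -> sD]] <-].
  rewrite fsumE// lee_fin; have [N0 sN0] := zero_sum_finite_box sD.
  apply: le_trans (pK N0); apply: ler_sum_subseq; rewrite ?box_uniq//.
  exact: sN0.
have e0 : (0 <= esum D (EFin \o p))%E by apply: esum_ge0 => t _; rewrite lee_fin.
have efin : esum D (EFin \o p) \is a fin_num.
  by rewrite ge0_fin_numE// (le_lt_trans eK)// ltry.
exists (fine (esum D (EFin \o p))); split; first by rewrite fineK.
move=> eta eta0.
have [_ [F /fsetsP[s [us -> sD]] <-]] := ub_ereal_sup_adherent eta0 efin.
rewrite -/(esum D _) fsumE// -[X in (X - _)%E](fineK efin) -EFinB lte_fin => /ltW Ps.
have [N0 sN0] := zero_sum_finite_box sD; exists N0 => N N0N.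
apply/andP; split.
  apply: le_trans Ps _; apply: ler_sum_subseq; rewrite ?box_uniq//.
  exact: sN0.
rewrite -lee_fin fineK// -fsumE ?box_uniq//.
by apply: ereal_sup_ubound; exists [set` box N].
Qed.

(** The bound on absolute values makes the sums of positive and negative parts finite, and
    [esum_box] applies to each. *)
Lemma unordered_sum_box (p : k.-tuple int -> R) (K : R) :
  (forall N, \sum_(t <- box N) `|p t| <= K) ->
  forall eta : R, 0 < eta -> exists N0, forall N, (N0 <= N)%N ->
    `|unordered_sum (@zero_sum_tuples k) p - \sum_(t <- box N) p t| <= eta.
Proof.
move=> pK eta eta0.
pose pp t := Num.max (p t) 0; pose pn t := Num.max (- p t) 0.
have pp0 t : 0 <= pp t by rewrite /pp le_max lexx orbT.
have pn0 t : 0 <= pn t by rewrite /pn le_max lexx orbT.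
have ppE : (EFin \o p)^\+%E = EFin \o pp by apply/funext => t; rewrite funeposE /= /pp EFin_max.
have pnE : (EFin \o p)^\-%E = EFin \o pn by apply/funext => t; rewrite funenegE /= /pn EFin_max.
have ppK N : \sum_(t <- box N) pp t <= K.
  apply: le_trans (pK N); apply: ler_sum => t _.
  by rewrite /pp ge_max normr_ge0 ler_norm.
have pnK N : \sum_(t <- box N) pn t <= K.
  apply: le_trans (pK N); apply: ler_sum => t _.
  by rewrite /pn ge_max normr_ge0 -normrN ler_norm.
have [P [PE PN]] := esum_box pp0 ppK; have [M [ME MN]] := esum_box pn0 pnK.
have [N1 H1] := PN _ eta0; have [N2 H2] := MN _ eta0.
exists (maxn N1 N2) => N; rewrite geq_max => /andP[/H1/andP[a b] /H2/andP[c d]].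
rewrite /unordered_sum ppE pnE PE ME/=.
have -> : \sum_(t <- box N) p t = \sum_(t <- box N) pp t - \sum_(t <- box N) pn t.
  rewrite -sumrB; apply: eq_bigr => t _; rewrite /pp /pn.
  by case: (lerP (p t) 0) => h; case: (lerP (- p t) 0) => h'; lra.
rewrite ler_norml; apply/andP; split; lra.
Qed.

End BoxSums.

(** * The main estimate *)

Section FinalBounds.
Variable R : realType.

Lemma H_term_index_tuple (k N : nat) (f : {ffun 'I_k -> bool * 'I_N}) :
  H_term (index_tuple f) = \prod_i beta R (f i).
Proof.
rewrite /H_term /beta big_split/= prodfV; congr (_ / _);
  by apply: eq_bigr => i _; rewrite tnth_index_tuple.
Qed.

Definition H_sum (k : nat) : R := unordered_sum (@zero_sum_tuples k) (@H_term R k).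

Definition H_box (k N : nat) : R :=
  \sum_(f : {ffun 'I_k -> bool * 'I_N} | \sum_i signed_index (f i) == 0) \prod_i beta R (f i).

Lemma alpha2_eq0 (N : nat) (x : bool * 'I_N) : alpha R 2 x = 0.
Proof.
rewrite /alpha /divisor_weight big1 ?mul0r// => j _.
by rewrite /cot_weight ifN ?mul0r//; lia.
Qed.

(* Comparing with [q = 2], where the approximating sum vanishes, yields absolute convergence. *)
Lemma H_term_bounded (k : nat) :
  exists K : R, forall N, \sum_(t <- box k N) `|H_term t| <= K.
Proof.
have [C C1 dC] := @num_divisors_le_powR R 2^-1 ltac:(by rewrite invr_gt0).
(* The comparison needs a factor [alpha] that vanishes; for k = 0 there is only the empty tuple,
   with term 1. *)
case: (posnP k) => [->|k0].
  exists 1 => N; rewrite big_box; apply: (@le_trans _ _ (\sum_(f : {ffun 'I_0 -> bool * 'I_N}) 1)).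
    rewrite big_mkcond; apply: ler_sum => f _; case: ifP => _ //.
    by rewrite H_term_index_tuple big_ord0 normr1.
  by rewrite sumr_const card_ffun card_ord expn0.
(* The bound of [zero_sum_error] at q = 2 and eps = sigma = 1/2, uniform in [N]. *)
exists (8 * k%:R ^+ 2 * C * 2%:R `^ (- (1 - 2^-1 - 2^-1)) * (2 * (1 + k%:R / 2^-1) ^+ 2) ^+ k.-1) => N.
have C0 : 0 <= C by apply: le_trans C1.
rewrite big_box; case: (posnP N) => [->|N0].
  rewrite big1 => [|f _]; last by have [] := (f (Ordinal k0)).2.
  by rewrite !mulr_ge0 ?exprn_ge0 ?powR_ge0 ?mulr_ge0 ?exprn_ge0 ?addr_ge0 ?divr_ge0.
have := @zero_sum_error R 2 isT N k C 2^-1 2^-1 N0 C0.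
move=> /(_ ltac:(by rewrite invr_gt0) ltac:(by rewrite invr_gt0) ltac:(lra) dC).
apply: le_trans; apply: ler_sum => f _.
by rewrite H_term_index_tuple [X in _ - X](bigD1 (Ordinal k0))//= alpha2_eq0 mul0r subr0.
Qed.

Lemma H_sum_box (k : nat) (eta : R) : 0 < eta -> exists N0, forall N, (N0 <= N)%N ->
  `|H_sum k - H_box k N| <= eta.
Proof.
have [K HK] := H_term_bounded k => /(unordered_sum_box HK)[N0 H0].
exists N0 => N /H0; rewrite big_box.
by under eq_bigr do rewrite H_term_index_tuple.
Qed.

Lemma H_sum_unique (k : nat) (x : R) : (forall N, H_box k N = x) -> H_sum k = x.
Proof.
move=> Hx; apply/eqP; rewrite -subr_eq0 -normr_eq0; apply/negPn/negP => d0.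
have d1 : 0 < `|H_sum k - x| by rewrite lt_neqAle eq_sym d0/=.
have [N0 /(_ N0 (leqnn _))] := @H_sum_box k (`|H_sum k - x| / 2) ltac:(by rewrite divr_gt0).
by rewrite Hx; lra.
Qed.

Lemma H_sum0 : H_sum 0 = 1.
Proof.
apply: H_sum_unique => N; rewrite /H_box (eq_bigl xpredT); last by move=> f; rewrite big_ord0 eqxx.
under eq_bigr do rewrite big_ord0.
by rewrite sumr_const card_ffun card_ord expn0.
Qed.

(** Negating all coordinates preserves the condition and multiplies each term by (-1)^k = -1. *)
Lemma H_sum_odd (k : nat) : odd k -> H_sum k = 0.
Proof.
move=> ok; apply: H_sum_unique => N; rewrite /H_box.
pose flip (f : {ffun 'I_k -> bool * 'I_N}) : {ffun 'I_k -> bool * 'I_N} :=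
  [ffun i => (~~ (f i).1, (f i).2)].
have flipK : involutive flip.
  by move=> f; apply/ffunP => i; rewrite !ffunE/= negbK; case: (f i).
have sN f i : signed_index (flip f i) = - signed_index (f i).
  by rewrite /signed_index ffunE/=; case: (f i).1; rewrite ?opprK.
set S := \sum_(f | _) _; suff : S = - S by lra.
rewrite {1}/S (reindex_inj (inv_inj flipK))/= -sumrN; apply: eq_big => f.
  by under eq_bigr do rewrite sN; rewrite sumrN oppr_eq0.
move=> _; have -> : \prod_i beta R (flip f i) = \prod_i - beta R (f i).
  apply: eq_bigr => i _; rewrite /beta sN abszN.
  by rewrite mulrNz invrN mulrN.
by rewrite prodrN card_ord -signr_odd ok expr1 mulN1r.
Qed.

(** Absorbs additive constants and spare powers of log q into the error term, as in 1 + 2 log q <= 4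
    log q. *)
Lemma ln_ge_half (q : nat) : (1 < q)%N -> 2^-1 <= ln (q%:R : R).
Proof.
move=> q1; apply: (@le_trans _ _ (ln 2)); last by rewrite ler_ln ?posrE ?ltr0n ?ler_nat// ltnW.
have := @le_ln1Dx R (- 2^-1); rewrite (_ : 1 + - 2^-1 = 2^-1 :> R); last by lra.
by rewrite lnV ?posrE// => /(_ ltac:(lra)); lra.
Qed.

Lemma norm_real_complex (x : R) : `|x%:C%C| = `|x|%:C%C :> R[i].
Proof. by rewrite normc_def/= expr0n/= addr0 sqrtr_sqr. Qed.

Lemma norm_i : `|'i%C| = 1 :> R[i].
Proof. by rewrite normc_def/= expr0n expr1n/= add0r sqrtr1. Qed.

(** Allows (i pi^2)^(-k) to be dropped from upper bounds. *)
Lemma norm_ipi_ge1 : 1 <= `|('i * ((pi : R) ^+ 2)%:C)%C|.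
Proof.
rewrite normrM norm_i mul1r norm_real_complex -[1]/((1%:C)%C) lecR.
have := pi_ge2 R; move: (pi : R) => p p2; rewrite ger0_norm ?exprn_ge0//; nra.
Qed.

Lemma harmonic_sum_sqr_le (q : nat) : (1 < q)%N ->
  harmonic_sum R (q ^ 2) <= 4 * ln q%:R.
Proof.
move=> q1; have l2 := ln_ge_half q1; have q0 := ltnW q1.
apply: le_trans (harmonic_le _ _) _; first by rewrite expn_gt0 q0.
by rewrite natrX lnXn ?ltr0n// mulr2n; lra.
Qed.

(** The divisor bound enters three times: d(n) <= C q^(2 eps) for n < q^2, 1/phi(q) <= d(q)/q <= C
    q^(eps - 1), and the d(q) choices of m. Together they give C^3 q^(4 eps - 1). *)
Lemma nonzero_sum_bound (q k N : nat) (C eps : R) : (1 < q)%N -> (0 < k)%N -> (q ^ 2 <= N)%N ->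
  1 <= C -> 0 < eps -> (forall n, (0 < n)%N -> (num_divisors n)%:R <= C * n%:R `^ eps) ->
  (totient q)%:R^-1 * \sum_(m <- divisors q)
      \sum_(f : {ffun 'I_k -> bool * 'I_N} | (\sum_i signed_index (f i) != 0) &&
           (q %/ m %| `|(\sum_i signed_index (f i))%R|)%N)
          (q %/ m)%:R * \prod_i `|alpha R q (f i)| <=
  C ^+ 3 * (q%:R `^ (- 1 + 4 * eps) * (9 * k%:R * ln q%:R) ^+ (2 * k)).
Proof.
move=> q1 k0 qN C1 e0 dC; have q0 := ltnW q1; have l2 := ln_ge_half q1.
have C0 : 0 <= C by apply: le_trans C1.
have qR : 0 < (q%:R : R) by rewrite ltr0n.
set L := ln q%:R in l2 *; have L0 : 0 <= L by lra.
set h := harmonic_sum R (q ^ 2).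
have h0 : 0 <= h by exact: harmonic_sum_ge0.
have hL : h <= 4 * L by exact: harmonic_sum_sqr_le.
set Q : R := q%:R `^ eps; have Q0 : 0 < Q by rewrite powR_gt0.
set D := C * Q ^+ 2; have D0 : 0 <= D by rewrite mulr_ge0 ?exprn_ge0 ?(ltW Q0).
have HD n : (0 < n < q ^ 2)%N -> (num_divisors n)%:R <= D.
  case/andP=> n0 nq; apply: le_trans (dC n n0) _; rewrite ler_wpM2l//.
  rewrite /Q -(powR_mulrn 2 (powR_ge0 q%:R eps)) -powRrM mulrC powRrM powR_mulrn//.
  by apply: ge0_ler_powR; rewrite ?nnegrE ?exprn_ge0 ?(ltW e0)// -natrX ler_nat ltnW.
set W := 2 * k%:R * k.+1%:R * h * (2 * h ^+ 2) ^+ k.-1.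
have W0 : 0 <= W by rewrite /W !mulr_ge0 ?exprn_ge0 ?mulr_ge0 ?exprn_ge0.
have phi_le : (totient q)%:R^-1 <= (num_divisors q)%:R / q%:R :> R.
  have p0 : 0 < ((totient q)%:R : R) by rewrite ltr0n totient_gt0.
  rewrite ler_pdivlMr// mulrC ler_pdivrMr// mulrC -natrM ler_nat.
  exact: leq_totient_num_divisors.
have dq0 : 0 <= ((num_divisors q)%:R : R) by [].
have dq : (num_divisors q)%:R <= C * Q by exact: dC.
apply: (@le_trans _ _ ((num_divisors q)%:R / q%:R * ((num_divisors q)%:R * (D * W)))).
  apply: ler_pM; rewrite ?invr_ge0//.
    by apply: sumr_ge0 => m _; apply: sumr_ge0 => f _; rewrite mulr_ge0// prodr_ge0.
  rewrite -[X in X%:R * (D * W)]/(size (divisors q)) -sum1_size natr_sum mulr_suml.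
  rewrite big_seq [leRHS]big_seq; apply: ler_sum => m; rewrite -dvdn_divisors// => mq.
  rewrite [leRHS]mul1r; apply: le_trans (nonzero_sum_error q1 k qN _ D0 HD) _.
    by rewrite divn_gt0 ?(dvdn_gt0 q0 mq)// dvdn_leq.
  rewrite /W -/h; move: ((2 * h ^+ 2) ^+ k.-1) => z.
  by rewrite le_eqVlt; apply/orP; left; apply/eqP; ring.
have eX : (9 * k%:R * L) ^+ (2 * k) = (9 * k%:R * L) ^+ 2 * ((9 * k%:R * L) ^+ 2) ^+ k.-1.
  by rewrite -exprS prednK// -exprM.
(* With L = log q >= 1/2 and h <= 4 L: 2 k (k + 1) h <= 16 k^2 L <= 81 k^2 L^2, and 2 h^2 <= 32 L^2
   <= (9 k L)^2. *)
have WL : W <= (9 * k%:R * L) ^+ (2 * k).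
  rewrite eX /W.
  have k1 : 1 <= (k%:R : R) by rewrite ler1n.
  apply: ler_pM; rewrite ?mulr_ge0 ?exprn_ge0 ?mulr_ge0 ?exprn_ge0//.
    rewrite -natr1.
    apply: (@le_trans _ _ (2 * k%:R * (2 * k%:R) * (4 * L))).
      rewrite ler_pM ?mulr_ge0// ?addr_ge0//.
      by rewrite ler_wpM2l ?mulr_ge0//; lra.
    have kk : 0 <= (k%:R : R) ^+ 2 by rewrite exprn_ge0.
    rewrite (_ : 2 * k%:R * (2 * k%:R) * (4 * L) = k%:R ^+ 2 * (16 * L)); last by ring.
    rewrite (_ : (9 * k%:R * L) ^+ 2 = k%:R ^+ 2 * (81 * (L * L))); last by ring.
    rewrite ler_wpM2l//; nra.
  rewrite lerXn2r ?nnegrE ?mulr_ge0 ?exprn_ge0//.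
  have h2 : h ^+ 2 <= (4 * L) ^+ 2 by rewrite lerXn2r ?nnegrE// (le_trans h0).
  apply: (@le_trans _ _ (2 * (4 * L) ^+ 2)); first by rewrite ler_wpM2l.
  rewrite (_ : 2 * (4 * L) ^+ 2 = L ^+ 2 * 32); last by ring.
  rewrite (_ : (9 * k%:R * L) ^+ 2 = L ^+ 2 * (81 * (k%:R * k%:R))); last by ring.
  by rewrite ler_wpM2l ?sqr_ge0//; nra.
have -> : q%:R `^ (- 1 + 4 * eps) = Q ^+ 4 / q%:R.
  rewrite /Q -(powR_mulrn 4 (powR_ge0 q%:R eps)) -powRrM mulrC.
  rewrite powRD; last by rewrite (gt_eqF qR) implybT.
  by rewrite powRN powRr1 ?(ltW qR)// [LHS]mulrC.
rewrite (_ : C ^+ 3 * _ = C * Q / q%:R * (C * Q * (D * (9 * k%:R * L) ^+ (2 * k)))); last first.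
  by rewrite /D; move: ((9 * k%:R * L) ^+ (2 * k)) => z; field; rewrite gt_eqF.
have DW0 : 0 <= D * W by exact: mulr_ge0.
apply: ler_pM; [exact: divr_ge0|exact: mulr_ge0 dq0 DW0|by rewrite ler_pM2r ?invr_gt0|].
by apply: ler_pM => //; rewrite ler_wpM2l.
Qed.

Lemma zero_sum_bound (q k N : nat) (C eps : R) : (1 < q)%N -> (0 < k)%N -> (0 < N)%N ->
  0 <= C -> 0 < eps -> eps <= 2^-1 ->
  (forall n, (0 < n)%N -> (num_divisors n)%:R <= C * n%:R `^ eps) ->
  \sum_(f : {ffun 'I_k -> bool * 'I_N} | \sum_i signed_index (f i) == 0)
     `|\prod_i beta R (f i) - \prod_i alpha R q (f i)| <=
  C * expR 4^-1 * (q%:R `^ (- 1 + eps) * (9 * k%:R * ln q%:R) ^+ (2 * k)).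
Proof.
move=> q1 k0 N0 C0 e0 e1 dC; have q0 := ltnW q1; have l2 := ln_ge_half q1.
have qR : 0 < (q%:R : R) by rewrite ltr0n.
set L := ln q%:R in l2 *.
have L0 : 0 < L by lra.
have k1 : 1 <= (k%:R : R) by rewrite ler1n.
(* Makes q^sigma = e^(1/4) constant, while log q >= 1/2 keeps sigma <= 1/2. *)
pose sigma := (4 * L)^-1.
have s0 : 0 < sigma by rewrite invr_gt0 mulr_gt0.
have s1 : sigma <= 2^-1 by rewrite lef_pV2 ?posrE ?mulr_gt0//; lra.
have es : eps + sigma <= 1 by lra.
apply: le_trans (zero_sum_error q1 k N0 C0 e0 s0 es dC) _.
have -> : q%:R `^ (- (1 - eps - sigma)) = expR 4^-1 * q%:R `^ (- 1 + eps).
  rewrite /powR gt_eqF// -expRD; congr expR; rewrite -/L /sigma; field.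
  by rewrite gt_eqF.
rewrite (_ : 8 * _ * _ * _ * _ = C * expR 4^-1 * (q%:R `^ (- 1 + eps) *
   (8 * k%:R ^+ 2 * (2 * (1 + k%:R / sigma) ^+ 2) ^+ k.-1))); last first.
  move: ((2 * (1 + k%:R / sigma) ^+ 2) ^+ k.-1) => z; ring.
rewrite ler_wpM2l ?mulr_ge0 ?expR_ge0//; rewrite ler_wpM2l ?powR_ge0//.
have eX : (9 * k%:R * L) ^+ (2 * k) = (9 * k%:R * L) ^+ 2 * ((9 * k%:R * L) ^+ 2) ^+ k.-1.
  by rewrite -exprS prednK// -exprM.
rewrite eX /sigma invrK.
have kk : 0 <= (k%:R : R) ^+ 2 by rewrite exprn_ge0.
have kL : 2^-1 <= k%:R * L by nra.
have L0' := ltW L0.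
have p0 : 0 <= 1 + k%:R * (4 * L) by rewrite addr_ge0 ?mulr_ge0.
(* As k L >= 1/2, 1 + 4 k L <= 6 k L, and twice its square is at most 72 (k L)^2 <= (9 k L)^2; also
   8 <= 81 L^2. *)
apply: ler_pM; rewrite ?mulr_ge0 ?exprn_ge0 ?mulr_ge0 ?exprn_ge0//; last first.
  rewrite lerXn2r ?nnegrE ?mulr_ge0 ?exprn_ge0 ?mulr_ge0 ?(ltW L0)// ?addr_ge0 ?mulr_ge0 ?(ltW L0)//.
  rewrite (_ : k%:R * (4 * L) = 4 * (k%:R * L)); last by ring.
  rewrite (_ : 9 * k%:R * L = 9 * (k%:R * L)); last by ring.
  by move: (k%:R * L) kL => y y2; rewrite !expr2; nra.
rewrite (_ : (9 * k%:R * L) ^+ 2 = k%:R ^+ 2 * (81 * (L * L))); last by ring.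
by rewrite mulrC ler_wpM2l//; nra.
Qed.

Lemma H_sumE (k : nat) : H k = ('i * ((pi : R) ^+ 2)%:C)%C ^- k * (H_sum k)%:C%C.
Proof. by []. Qed.

(** The second divisor bound has exponent eps/4 because [nonzero_sum_bound] loses four times its
    exponent. *)
Lemma moment_bound (q k : nat) (C C' eps : R) : (1 < q)%N -> (0 < k)%N ->
  1 <= C -> 1 <= C' -> 0 < eps -> eps <= 2^-1 ->
  (forall n, (0 < n)%N -> (num_divisors n)%:R <= C * n%:R `^ eps) ->
  (forall n, (0 < n)%N -> (num_divisors n)%:R <= C' * n%:R `^ (eps / 4)) ->
  `| ((totient q)%:R^-1 *
        \sum_(1 <= a < q.+1 | coprime a q) c0 a%:Z q ^+ k)%:C%C
     - H k * q%:R ^+ k | <=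
  (q%:R ^+ k * ((C * expR 4^-1 + C' ^+ 3 + 1) *
     (q%:R `^ (- 1 + eps) * (9 * k%:R * ln q%:R) ^+ (2 * k))))%:C%C :> R[i].
Proof.
move=> q1 k0 C1 C1' e0 e1 dC dC'; have q0 := ltnW q1; have l2 := ln_ge_half q1.
have qR : 0 < (q%:R : R) by rewrite ltr0n.
set W := q%:R `^ (- 1 + eps) * (9 * k%:R * ln q%:R) ^+ (2 * k).
have W0 : 0 < W by rewrite mulr_gt0 ?powR_gt0 ?exprn_gt0 ?mulr_gt0 ?ltr0n//; lra.
(* The tolerance for truncating H_k is the error term itself, which gives the final [1] in the
   constant. *)
have [N0 HN] := H_sum_box k W0.
pose N := maxn N0 (q ^ 2); have qN : (q ^ 2 <= N)%N by rewrite leq_maxr.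
have Np : (0 < N)%N by apply: leq_trans qN; rewrite expn_gt0 q0.
have [E [-> EN]] := moment_expansion R q1 k qN.
set S := \sum_(f | _) _.
have SH : `|S - H_sum k| <= (C * expR 4^-1 + 1) * W.
  have -> : S - H_sum k = - (H_box k N - S) - (H_sum k - H_box k N) by ring.
  apply: le_trans (ler_normB _ _) _; rewrite normrN mulrDl mul1r; apply: lerD; last first.
    by apply: HN; rewrite leq_maxl.
  rewrite /H_box /S -sumrB; apply: le_trans (ler_norm_sum _ _ _) _.
  exact: (zero_sum_bound q1 k0 Np (le_trans ler01 C1) e0 e1 dC).
have EW : `|E| <= (C' ^+ 3 * W)%:C%C.
  apply: le_trans EN _; rewrite lecR.
  have e4 : 0 < eps / 4 by rewrite divr_gt0.
  apply: le_trans (nonzero_sum_bound q1 k0 qN C1' e4 dC') _.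
  by rewrite (_ : - 1 + 4 * (eps / 4) = - 1 + eps)//; field.
have factor (Q z s h x : R[i]) : Q * z * (s + x) - z * h * Q = Q * z * ((s - h) + x) by ring.
rewrite H_sumE factor -rmorphB/=.
rewrite normrM normrM normrX normr_nat normrV ?unitfE ?normrX; last first.
  by rewrite expf_neq0// -normr_gt0 (lt_le_trans ltr01 norm_ipi_ge1).
rewrite [in leRHS]rmorphM/= [in leRHS]rmorphXn/= rmorph_nat -mulrA ler_wpM2l ?exprn_ge0//.
apply: (@le_trans _ _ `|(S - H_sum k)%:C%C + E|).
  rewrite ler_piMl// invf_le1 ?exprn_ege1 ?norm_ipi_ge1//.
  by rewrite exprn_gt0// (lt_le_trans ltr01 norm_ipi_ge1).
apply: le_trans (ler_normD _ _) _.
rewrite (_ : (_ + 1) * W = (C * expR 4^-1 + 1) * W + C' ^+ 3 * W); last by ring.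
by rewrite [leRHS]rmorphD/=; apply: lerD EW; rewrite norm_real_complex lecR.
Qed.

Lemma moment0 (q : nat) : (0 < q)%N ->
  (totient q)%:R^-1 * \sum_(1 <= a < q.+1 | coprime a q) c0 a%:Z q ^+ 0 = 1 :> R.
Proof.
move=> q0; under eq_bigr do rewrite expr0.
have -> : \sum_(1 <= a < q.+1 | coprime a q) (1 : R) = (totient q)%:R.
  rewrite totient_count_coprime natr_sum; case: (leqP q 1) => [q1|q1].
    by have -> : q = 1%N by [lia]; rewrite big_mkcond !big_nat1.
  rewrite (@sum_coprime_inv _ q (fun=> 1) (fun=> 1) q1)// [LHS]big_mkcond/=.
  by apply: eq_bigr => b _; rewrite coprime_sym; case: ifP.
by rewrite mulVf// pnatr_eq0 -lt0n totient_gt0.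
Qed.

End FinalBounds.

(* The pairs with q = 1 and k >= 2 even are left out: there log q = 0, so the
   error term vanishes, while c_0(1/1) = 0 and H_k <> 0. *)
Theorem theorem1p1 (R : realType) :
  exists A : R, 0 < A /\
    forall eps : R, 0 < eps ->
      exists C : R,
        forall q k : nat, (1 <= q)%N ->
          ~ (q = 1%N /\ (2 <= k)%N /\ ~~ odd k) ->
          `| ((totient q)%:R^-1 *
                \sum_(1 <= a < q.+1 | coprime a q) c0 a%:Z q ^+ k)%:C%C
             - H k * q%:R ^+ k | <=
          (C * (q%:R `^ (k%:R - 1 + eps)
                * (A * k%:R * ln q%:R) ^+ (2 * k)))%:C%C :> R[i].
Proof.
(* The 9 of (9 k log q)^(2k) in both error bounds. *)
exists 9; split=> // eps eps0.
(* [zero_sum_bound] asks for an exponent at most 1/2; a larger eps only weakens the claim. *)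
pose e := Num.min eps 2^-1.
have e0 : 0 < e by rewrite lt_min eps0 invr_gt0/=.
have e1 : e <= 2^-1 by rewrite ge_min lexx orbT.
have ee : e <= eps by rewrite ge_min lexx.
have [C C1 dC] := num_divisors_le_powR e0.
have [C' C1' dC'] := @num_divisors_le_powR R (e / 4) ltac:(by rewrite divr_gt0).
have C0 : 0 <= C by apply: le_trans C1.
have C0' : 0 <= C' by apply: le_trans C1'.
have K0 : 0 <= C * expR 4^-1 + C' ^+ 3 + 1.
  by rewrite !addr_ge0 ?exprn_ge0 ?mulr_ge0 ?expR_ge0.
exists (C * expR 4^-1 + C' ^+ 3 + 1) => q k q0 hqk.
case: (posnP k) => [->|k0].
  rewrite moment0// H_sumE H_sum0 !expr0 invr1 !mul1r mulr1 subrr normr0.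
  by rewrite -[0]/((0%:C)%C) lecR !mulr_ge0 ?powR_ge0.
(* At q = 1 the remaining k are odd: the cotangent sum is empty, H_k = 0 and log 1 = 0, so both
   sides vanish. *)
case: (leqP q 1) => [q1|q1].
  have qE : q = 1%N by apply/eqP; rewrite eqn_leq q1 q0.
  have ok : odd k.
    by apply/negPn/negP => ek; apply: hqk; split=> //; split=> //; move: ek; case: (k) k0 => [|[]].
  subst q; rewrite H_sumE H_sum_odd// mulr0 mul0r subr0 ln1 mulr0 expr0n.
  rewrite muln_eq0 (gtn_eqF k0)/= !mulr0.
  rewrite big_mkcond big_nat1/= /c0 big_geq// oppr0 expr0n (gtn_eqF k0)/=.
  by rewrite mulr0 normr0.
apply: le_trans (moment_bound q1 k0 C1 C1' e0 e1 dC dC') _; rewrite lecR mulrCA.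
rewrite ler_wpM2l// mulrA ler_wpM2r ?exprn_ge0 ?mulr_ge0 ?ln_ge0 ?ler1n//.
have qR : 0 < (q%:R : R) by rewrite ltr0n.
rewrite -powR_mulrn// -powRD; last by rewrite (gt_eqF qR) implybT.
by rewrite ler_powR ?ler1n// addrA lerD2l.
Qed.
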